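(* Let $f\in W^{-1,s}(\Omega)$ and $f_D\in W^{1-1/s,s}(\tilde\Gamma)$. Let $u\in U_{\mathrm{ad}}$ and assume that $q\ge\frac{2s}{s-2}$. Then the control-to-state operator $S:(U_{\mathrm{ad}},\|\cdot\|_{L^q(\Omega)})\to W^{1,2}(\Omega)$ is Fréchet differentiable at $u$ with respect to feasible variations. Moreover, given $u\in U_{\mathrm{ad}}$ and $\phi\in L^q(\Omega)$ such that $u+\phi\in U_{\mathrm{ad}}$, and with $y=S(u)$, $S'(u)[\phi]$ is the unique solution $z\in W^{1,2}_{\tilde\Gamma}(\Omega)$ to $$\int_\Omega u\nabla z\cdot\nabla v\,dx=-\int_\Omega\phi\nabla y\cdot\nabla v\,dx\quad\text{for all }v\in W^{1,2}_{\tilde\Gamma}(\Omega).$$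
   Context: Setting. $\Omega\subset\mathbb{R}^d$, $d\ge2$, is a bounded domain with Lipschitz boundary of class $C^{1,\alpha}$; $\tilde\Gamma,\Gamma\subset\partial\Omega$ (Dirichlet and Neumann part of the boundary) are nonempty, closed and of positive surface measure. The set $\Omega\cup\Gamma$ is regular in the sense of Gröger: a bounded set $G\subset\mathbb{R}^d$ is regular if for each $x\in\partial G$ there are an open neighbourhood $U$ of $x$ and a bi-Lipschitz map $\Phi$ from $U$ onto an open subset of $\mathbb{R}^d$ with $\Phi(x)=0$ such that $\Phi(U\cap G)$ is one of $E_1=\{|z|<1,z_d<0\}$, $E_2=\{|z|<1,z_d\le0\}$, $E_3=\{z\in E_2: z_d<0\text{ or }z_1>0\}$. Spaces. $W^{1,p}_{\tilde\Gamma}(\Omega)$ is the closed subspace of $W^{1,p}(\Omega)$ of functions with vanishing trace on $\tilde\Gamma$; $W^{-1,p}(\Omega)$ is the dual of $W^{1,p'}_{\tilde\Gamma}(\Omega)$, $p'=p/(p-1)$. $0<u_\ell\le u_u$ are fixed scalars and $U_{\mathrm{ad}}=\{u\in BV(\Omega): u_\ell\le u(x)\le u_u\text{ for a.e. }x\in\Omega\}$. Dirichlet lift. The boundary setting is such that for every $p>1$ and $f_D\in W^{1-1/p,p}(\tilde\Gamma)$ the problem $-\Delta w=0$ in $\Omega$, $w=f_D$ on $\tilde\Gamma$, $\nabla w\cdot\nu=0$ on $\Gamma$ has a unique solution $\tilde f_D\in W^{1,p}(\Omega)$, with $\|\tilde f_D\|_{W^{1,p}}\le C(p)\|f_D\|_{W^{1-1/p,p}(\tilde\Gamma)}$.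 Control-to-state operator. For $u\in U_{\mathrm{ad}}$, $S(u)$ is the unique $y\in W^{1,2}(\Omega)$ with $y-\tilde f_D\in W^{1,2}_{\tilde\Gamma}(\Omega)$ and $\int_\Omega u\nabla y\cdot\nabla v\,dx=\langle f,v\rangle$ for all $v\in W^{1,2}_{\tilde\Gamma}(\Omega)$. The exponent $s$. $s>2$ is a fixed exponent (it exists by Gröger's regularity theory) such that for every $\sigma\in[2,s]$ there is $C(\sigma)\ge0$ such that for all $f\in W^{-1,\sigma}(\Omega)$, $f_D\in W^{1-1/\sigma,\sigma}(\tilde\Gamma)$, $u\in U_{\mathrm{ad}}$: $\|S(u)\|_{W^{1,\sigma}}\le C(\sigma)(\|f_D\|_{W^{1-1/\sigma,\sigma}(\tilde\Gamma)}+\|f\|_{W^{-1,\sigma}})$. A map $T:U_{\mathrm{ad}}\to Z$ into a Banach space $Z$ is Fréchet differentiable at $u$ with respect to feasible variations and a norm $\|\cdot\|_X$ if there is $T'(u)\in\mathcal{L}(X,Z)$ with $\|T(u+\phi)-T(u)-T'(u)\phi\|_Z/\|\phi\|_X\to0$ as $\|\phi\|_X\to0$ with $u+\phi\in U_{\mathrm{ad}}$. *)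

(* Defs.v *)
From HB Require Import structures.
From mathcomp Require Import all_boot all_order all_algebra.
From mathcomp Require Import all_classical all_reals all_analysis.

Set Implicit Arguments.
Unset Strict Implicit.
Unset Printing Implicit Defensive.

Import Order.TTheory GRing.Theory Num.Theory.
Import numFieldNormedType.Exports.

Local Open Scope classical_set_scope.
Local Open Scope ring_scope.

Section cover_outer.
Context {R : realType} {T : pointedType}.
Local Open Scope ereal_scope.

Definition cover_outer (h : set T -> \bar R) (A : set T) : \bar R :=
  ereal_inf [set \sum_(k <oo) h (F k) |
             F in [set F : nat -> set T | A `<=` \bigcup_k F k]].

(* [mu_ext] on the sigma-algebra of all subsets *)
Lemma cover_outerE (h : set T -> \bar R) :
  cover_outer h = @mu_ext _ (g_sigma_algebraType [set: set T]) R h.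
Proof.
apply/funext => A; congr ereal_inf; apply/seteqP; split => x [F].
- move=> AF <-; exists F => //; split=> // i.
  exact: sub_sigma_algebra.
- by move=> [_ AF] <-; exists F.
Qed.

Section laws.
Variable h : set T -> \bar R.
Hypotheses (h0 : h set0 = 0) (h_ge0 : forall A, 0 <= h A).

Lemma cover_outer0 : cover_outer h set0 = 0.
Proof. by rewrite cover_outerE; exact: mu_ext0. Qed.

Lemma cover_outer_ge0 A : 0 <= cover_outer h A.
Proof. by rewrite cover_outerE; exact: mu_ext_ge0. Qed.

Lemma le_cover_outer : {homo cover_outer h : A B / A `<=` B >-> A <= B}.
Proof. by rewrite cover_outerE => A B AB; exact: (@le_mu_ext _ (g_sigma_algebraType [set: set T]) R h A B AB). Qed.

Lemma cover_outer_sigma_subadditive : sigma_subadditive (cover_outer h).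
Proof.
rewrite cover_outerE => F.
exact: (@mu_ext_sigma_subadditive _ (g_sigma_algebraType [set: set T]) R h).
Qed.

End laws.

Definition caratheodory_measure (mu : {outer_measure set T -> \bar R}) :
    {measure set (caratheodory_type mu) -> \bar R} :=
  (mu : set (caratheodory_type mu) -> \bar R).

End cover_outer.

Section lebesgue_rV.
Context (R : realType) (n : nat).
Local Notation V := 'rV[R]_n.+1.
Local Open Scope ereal_scope.

Definition box (a b : V) : set V :=
  [set x | forall i, (a ord0 i < x ord0 i <= b ord0 i)%R].

(* The volume of a box, and +oo for a set that is not a box. *)
Definition box_volume (A : set V) : \bar R :=
  ereal_inf [set (\prod_i (ab.2 ord0 i - ab.1 ord0 i))%:E |
    ab in [set ab : V * V |
      (forall i, (ab.1 ord0 i <= ab.2 ord0 i)%R) /\ A = box ab.1 ab.2]].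

Lemma box_volume_ge0 A : 0 <= box_volume A.
Proof.
apply: le_ereal_inf_tmp => _ [[a b] /= [ab _] <-].
by rewrite lee_fin; apply: prodr_ge0 => i _; rewrite subr_ge0.
Qed.

Lemma box_volume0 : box_volume set0 = 0.
Proof.
apply/eqP; rewrite eq_le box_volume_ge0 andbT.
apply: ereal_inf_lbound; exists (0%R, 0%R) => /=.
  split=> // ; apply/seteqP; split => x //= /(_ ord0).
  by rewrite !mxE => /andP[/lt_le_trans/[apply]]; rewrite ltxx.
by rewrite (bigD1 ord0)//= subrr mul0r.
Qed.

Definition lebesgue_outer : set V -> \bar R := cover_outer box_volume.

HB.instance Definition _ := isOuterMeasure.Build R V lebesgue_outer
  (cover_outer0 box_volume0 box_volume_ge0) (cover_outer_ge0 box_volume_ge0)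
  (@le_cover_outer _ _ box_volume)
  (cover_outer_sigma_subadditive box_volume_ge0).

Definition lebesgue_rV :
    {measure set (caratheodory_type lebesgue_outer) -> \bar R} :=
  caratheodory_measure lebesgue_outer.

End lebesgue_rV.

Section euclidean.
Context {R : realType} {n : nat}.

(* The norm that the library puts on 'rV is the maximum norm. *)
Definition enorm (x : 'rV[R]_n) : R := Num.sqrt (\sum_i x ord0 i ^+ 2).

Definition diam (A : set 'rV[R]_n) : \bar R :=
  ereal_sup ([set 0%E] `|`
    [set (enorm (xy.1 - xy.2))%:E | xy in [set xy | A xy.1 /\ A xy.2]]).

End euclidean.

Section hausdorff.
Context (R : realType) (n : nat).
Local Notation V := 'rV[R]_n.+2.
Local Open Scope ereal_scope.

(* volume of the ball of diameter 1 in R^(n+1) *)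
Definition hausdorff_const : \bar R :=
  lebesgue_outer [set x : 'rV[R]_n.+1 | (enorm x < 1)%R] * (2^-1 ^+ n.+1)%R%:E.

Definition hausdorff_gauge (delta : R) (A : set V) : \bar R :=
  if diam A <= delta%:E then hausdorff_const * diam A ^+ n.+1 else +oo.

(* The dimension of the measure is n + 1, that of hypersurfaces of R^(n+2). *)
Definition hausdorff_outer (A : set V) : \bar R :=
  ereal_sup [set cover_outer (hausdorff_gauge delta) A |
             delta in [set delta : R | (0 < delta)%R]].

Lemma diam_ge0 k (A : set 'rV[R]_k) : 0 <= diam A.
Proof. by apply: ereal_sup_ubound; left. Qed.

Lemma diam0 k : diam (set0 : set 'rV[R]_k) = 0.
Proof.
apply/eqP; rewrite eq_le diam_ge0 andbT.
by apply: ge_ereal_sup => x [->|[xy [] []]].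
Qed.

Lemma hausdorff_gauge_ge0 delta A : 0 <= hausdorff_gauge delta A.
Proof.
rewrite /hausdorff_gauge; case: ifP => // _; apply: mule_ge0.
  apply: mule_ge0; first exact: outer_measure_ge0.
  by rewrite lee_fin exprn_ge0// invr_ge0.
by apply: expe_ge0; exact: diam_ge0.
Qed.

Lemma hausdorff_gauge0 delta : (0 < delta)%R -> hausdorff_gauge delta set0 = 0.
Proof.
by move=> d0; rewrite /hausdorff_gauge diam0 lee_fin ltW// expeS mul0e mule0.
Qed.

Lemma hausdorff_outer0 : hausdorff_outer set0 = 0.
Proof.
apply/eqP; rewrite eq_le; apply/andP; split.
  apply: ge_ereal_sup => _ [d /= d0 <-].
  rewrite cover_outer0 ?hausdorff_gauge0//.
  by move=> A; exact: hausdorff_gauge_ge0.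
apply: ereal_sup_ubound; exists 1%R => //=.
rewrite cover_outer0 ?hausdorff_gauge0//.
by move=> A; exact: hausdorff_gauge_ge0.
Qed.

Lemma hausdorff_outer_ge0 A : 0 <= hausdorff_outer A.
Proof.
apply: le_trans (ereal_sup_ubound _); last by exists 1%R => //=.
by apply: cover_outer_ge0 => B; exact: hausdorff_gauge_ge0.
Qed.

Lemma le_hausdorff_outer :
  {homo hausdorff_outer : A B / A `<=` B >-> A <= B}.
Proof.
move=> A B AB; apply: ge_ereal_sup => _ [d /= d0 <-].
apply: le_trans (ereal_sup_ubound _); last by exists d.
exact: le_cover_outer.
Qed.

Lemma hausdorff_outer_sigma_subadditive : sigma_subadditive hausdorff_outer.
Proof.
move=> F; apply: ge_ereal_sup => _ [d /= d0 <-].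
apply: le_trans (cover_outer_sigma_subadditive _ F) _.
  by move=> A; exact: hausdorff_gauge_ge0.
apply: lee_nneseries => k *.
  by apply: cover_outer_ge0 => A; exact: hausdorff_gauge_ge0.
by apply: ereal_sup_ubound; exists d.
Qed.

HB.instance Definition _ := isOuterMeasure.Build R V hausdorff_outer
  hausdorff_outer0 hausdorff_outer_ge0 le_hausdorff_outer
  hausdorff_outer_sigma_subadditive.

Definition surface_measure :
    {measure set (caratheodory_type hausdorff_outer) -> \bar R} :=
  caratheodory_measure hausdorff_outer.

End hausdorff.

Arguments lebesgue_rV {R n}.
Arguments surface_measure {R n}.

Section smooth.
Context {R : realType} {n : nat}.
Local Notation V := 'rV[R]_n.+1.

Definition basis_vec (i : 'I_n.+1) : V := delta_mx ord0 i.

Definition pderiv (i : 'I_n.+1) (f : V -> R) : V -> R :=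
  fun x => 'D_(basis_vec i) f x.

Definition C1 (f : V -> R) : Prop :=
  forall i, (forall x, derivable f x (basis_vec i)) /\ continuous (pderiv i f).

Definition smooth (f : V -> R) : Prop :=
  forall l : seq 'I_n.+1, let g := foldr pderiv f l in
    continuous g /\ forall i x, derivable g x (basis_vec i).

Definition compactly_supported_in (Omega : set V) (f : V -> R) : Prop :=
  let K := closure [set x | f x != 0] in compact K /\ K `<=` Omega.

Definition C1alpha (alpha : R) (f : V -> R) : Prop :=
  C1 f /\ exists K : R, forall i x y,
    `|pderiv i f x - pderiv i f y| <= K * enorm (x - y) `^ alpha.

End smooth.

Section domains.
Context {R : realType} {n : nat}.
Local Notation V := 'rV[R]_n.+2.
Implicit Types (Omega G : set V).

Definition boundary (A : set V) : set V := closure A `\` interior A.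

Definition bounded_domain Omega : Prop :=
  [/\ Omega !=set0, open Omega, connected Omega & bounded_set Omega].

(* Near each boundary point, Omega is, in suitable orthonormal coordinates
   z = y Q, the region z_d < psi(z_1, ..., z_(d-1)). *)
Definition C1alpha_boundary (alpha : R) Omega : Prop :=
  forall x, boundary Omega x ->
  exists (U : set V) (Q : 'M[R]_n.+2) (psi : 'rV[R]_n.+1 -> R),
    [/\ open U, U x, Q *m Q^T = 1%:M, C1alpha alpha psi &
        forall y, U y -> let z := y *m Q in
          Omega y <-> z ord0 ord_max < psi (col' ord_max z)].

Definition groger_E1 : set V := [set z | enorm z < 1 /\ z ord0 ord_max < 0].
Definition groger_E2 : set V := [set z | enorm z < 1 /\ z ord0 ord_max <= 0].
Definition groger_E3 : set V :=
  [set z | groger_E2 z /\ (z ord0 ord_max < 0 \/ 0 < z ord0 ord0)].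

Definition groger_regular G : Prop :=
  bounded_set G /\
  forall x, boundary G x -> exists (U : set V) (Phi : V -> V) (L : R),
    [/\ open U, U x, open (Phi @` U), Phi x = 0 &
     [/\ 0 < L,
      forall a b, U a -> U b ->
        L^-1 * enorm (a - b) <= enorm (Phi a - Phi b) <= L * enorm (a - b) &
      [\/ Phi @` (U `&` G) = groger_E1,
          Phi @` (U `&` G) = groger_E2 |
          Phi @` (U `&` G) = groger_E3]]].

End domains.

(* Spaces of classes of functions are represented by representatives: each
   space is a predicate together with an extended real valued seminorm, and two
   elements are identified when the seminorm of their difference is 0. *)

Section spaces.
Context {R : realType} {n : nat}.
Local Notation V := 'rV[R]_n.+2.
Local Notation I := 'I_n.+2.
Local Notation leb := (@lebesgue_rV R n.+1).
Local Notation surf := (@surface_measure R n).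
Implicit Types (Omega Gam : set V) (p : R).

Definition Lp Omega (p : \bar R) : set (V -> R) :=
  [set f | (f \_ Omega : _ -> R) \in Lfun leb p].
Definition Lp_norm Omega (p : \bar R) (f : V -> R) : \bar R :=
  'N[leb]_p[EFin \o (f \_ Omega)]%E.

Definition surface_Lp Gam p : set (V -> R) :=
  [set f | (f \_ Gam : _ -> R) \in Lfun surf p%:E].
Definition surface_Lp_norm Gam p (f : V -> R) : \bar R :=
  'N[surf]_(p%:E)[EFin \o (f \_ Gam)]%E.

(* An element of a Sobolev space is given by a representative of the function
   and a representative of its weak gradient. *)
Definition sob : Type := ((V -> R) * (I -> V -> R))%type.
HB.instance Definition _ := GRing.Lmodule.on sob.

Definition weak_gradient Omega (w : V -> R) (g : I -> V -> R) : Prop :=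
  forall (phi : V -> R) (i : I), smooth phi -> compactly_supported_in Omega phi ->
    \int[leb]_(x in Omega) (w x * pderiv i phi x)
    = - \int[leb]_(x in Omega) (g i x * phi x).

Definition W1 Omega p : set sob :=
  [set w | [/\ Lp Omega p%:E w.1, (forall i, Lp Omega p%:E (w.2 i)) &
               weak_gradient Omega w.1 w.2]].
Definition W1_norm Omega p (w : sob) : \bar R :=
  (Lp_norm Omega p%:E w.1 + \sum_i Lp_norm Omega p%:E (w.2 i))%E.

Definition grad_dot (v w : sob) (x : V) : R := \sum_i v.2 i x * w.2 i x.

(* The graph of the trace operator W^{1,p}(Omega) -> L^p(boundary): the closure
   of the restriction of smooth functions to the boundary. *)
Definition is_trace Omega p (w : sob) (g : V -> R) : Prop :=
  surface_Lp (boundary Omega) p g /\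
  exists phi : nat -> V -> R,
    [/\ forall k, smooth (phi k),
        forall k, surface_Lp (boundary Omega) p (phi k),
        forall k, W1 Omega p (phi k, fun i => pderiv i (phi k)),
        W1_norm Omega p (((phi k, fun i => pderiv i (phi k)) : sob) - w)
          @[k --> \oo] --> 0%E &
        surface_Lp_norm (boundary Omega) p (phi k - g) @[k --> \oo] --> 0%E].

Definition trace_on Omega Gam p (w : sob) (h : V -> R) : Prop :=
  exists g, is_trace Omega p w g /\ {ae surf, forall x, Gam x -> g x = h x}.

Definition W10 Omega Gam p : set sob :=
  [set w | W1 Omega p w /\ trace_on Omega Gam p w (cst 0)].

Definition conj_exp p : R := p / (p - 1).

(* W^{-1,p}: bounded linear functionals on W10 Omega Gam p' *)
Definition dual_norm Omega Gam p (F : sob -> R) : \bar R :=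
  ereal_sup [set `|F v|%:E | v in [set v |
    W10 Omega Gam (conj_exp p) v /\ (W1_norm Omega (conj_exp p) v <= 1)%E]].
Definition Wm1 Omega Gam p : set (sob -> R) :=
  [set F | (forall (a : R) (v w : sob),
              W10 Omega Gam (conj_exp p) v -> W10 Omega Gam (conj_exp p) w ->
              F (a *: v + w) = a * F v + F w) /\
           exists M : R, forall v, W10 Omega Gam (conj_exp p) v ->
             (`|F v|%:E <= M%:E * W1_norm Omega (conj_exp p) v)%E].

(* Sobolev-Slobodeckij space W^{1-1/p,p}(Gam). The kernel has the exponent
   (d-1) + (1-1/p) p = d + p - 2 = n + p. *)
Definition slobodeckij_norm Gam p (g : V -> R) : \bar R :=
  ((\int[surf]_(x in Gam) (`|g x| `^ p)%:E +
    \int[surf]_(x in Gam) \int[surf]_(y in Gam)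
      (`|g x - g y| `^ p / enorm (x - y) `^ (n%:R + p))%:E) `^ p^-1)%E.
Definition slobodeckij Gam p : set (V -> R) :=
  [set g | surface_Lp Gam p g /\ (slobodeckij_norm Gam p g < +oo)%E].

Definition divergence (phi : I -> V -> R) (x : V) : R :=
  \sum_i pderiv i (phi i) x.

Definition variation_in Omega (u : V -> R) : \bar R :=
  ereal_sup [set (\int[leb]_(x in Omega) (u x * divergence phi x)%:E)%E |
    phi in [set phi : I -> V -> R |
      (forall i, C1 (phi i) /\ compactly_supported_in Omega (phi i)) /\
      forall x, enorm (\row_i phi i x) <= 1]].

Definition BVspace Omega : set (V -> R) :=
  [set u | Lp Omega 1%E u /\ (variation_in Omega u < +oo)%E].

Definition Uad Omega (ul uu : R) : set (V -> R) :=
  [set u | BVspace Omega u /\ {ae leb, forall x, Omega x -> ul <= u x <= uu}].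

End spaces.

Section state.
Context {R : realType} {n : nat}.
Local Notation V := 'rV[R]_n.+2.
Local Notation leb := (@lebesgue_rV R n.+1).
Variables (Omega Gamt : set V).

(* Weak form of: - Laplace w = 0 in Omega, w = fD on the Dirichlet part, and
   homogeneous Neumann condition on the rest of the boundary. *)
Definition is_lift (p : R) (fD : V -> R) (w : sob) : Prop :=
  [/\ W1 Omega p w, trace_on Omega Gamt p w fD &
      forall v, W10 Omega Gamt (conj_exp p) v ->
        \int[leb]_(x in Omega) grad_dot w v x = 0].

Definition dirichlet_lift_setting : Prop :=
  forall p : R, 1 < p -> exists C : R, forall fD, slobodeckij Gamt p fD ->
    exists w, [/\ is_lift p fD w,
      forall w', is_lift p fD w' -> W1_norm Omega p (w' - w) = 0%E &
      (W1_norm Omega p w <= C%:E * slobodeckij_norm Gamt p fD)%E].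

(* For p >= 2 and data fD in W^{1-1/p,p}, the lift of exponent p is also the
   lift of exponent 2. *)
Definition is_state (f : sob -> R) (fD u : V -> R) (y : sob) : Prop :=
  [/\ W1 Omega 2 y,
      exists w, is_lift 2 fD w /\ W10 Omega Gamt 2 (y - w) &
      forall v, W10 Omega Gamt 2 v ->
        \int[leb]_(x in Omega) (u x * grad_dot y v x) = f v].

Definition ctrl_to_state (f : sob -> R) (fD u : V -> R) : sob :=
  xget 0 [set y | is_state f fD u y].

(* ctrl_to_state is the unique solution; without this, xget returns 0 where
   there is no solution. *)
Definition state_well_posed (U : set (V -> R)) (s : R) : Prop :=
  forall sigma : R, 2 <= sigma <= s ->
  forall f fD u, Wm1 Omega Gamt sigma f -> slobodeckij Gamt sigma fD -> U u ->
    exists y, is_state f fD u y /\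
      forall y', is_state f fD u y' -> W1_norm Omega 2 (y' - y) = 0%E.

Definition groger_exponent (U : set (V -> R)) (s : R) : Prop :=
  forall sigma : R, 2 <= sigma <= s -> exists C : R, 0 <= C /\
  forall f fD u, Wm1 Omega Gamt sigma f -> slobodeckij Gamt sigma fD -> U u ->
    (W1_norm Omega sigma (ctrl_to_state f fD u) <=
     C%:E * (slobodeckij_norm Gamt sigma fD + dual_norm Omega Gamt sigma f))%E.

Definition is_linearized_state (u : V -> R) (y : sob) (phi : V -> R) (z : sob) :
    Prop :=
  W10 Omega Gamt 2 z /\
  forall v, W10 Omega Gamt 2 v ->
    \int[leb]_(x in Omega) (u x * grad_dot z v x)
    = - \int[leb]_(x in Omega) (phi x * grad_dot y v x).

End state.

Section frechet.
Context {R : realType} {X Z : lmodType R}.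
Variables (DX : set X) (NX : X -> \bar R) (DZ : set Z) (NZ : Z -> \bar R).

(* Bounded linear operators between the spaces of classes; linearity is up to
   the identification given by the seminorm NZ. *)
Definition bounded_linear (T : X -> Z) : Prop :=
  [/\ forall x, DX x -> DZ (T x),
      forall (a : R) x y, DX x -> DX y ->
        NZ (T (a *: x + y) - (a *: T x + T y)) = 0%E &
      exists M : R, forall x, DX x -> (NZ (T x) <= M%:E * NX x)%E].

Definition is_feasible_derivative (U : set X) (T : X -> Z) (u : X)
    (T' : X -> Z) : Prop :=
  bounded_linear T' /\
  forall eps : R, 0 < eps -> exists2 delta : R, 0 < delta &
    forall phi, DX phi -> U (u + phi) -> (0 < NX phi < delta%:E)%E ->
      (NZ (T (u + phi) - T u - T' phi)%R <= eps%:E * NX phi)%E.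

End frechet.

(* Main.v *)
(* Write y = S(u), d = S(u + phi) - y and 1/2 = 1/r + 1/s, so that r <= q. The
   linearized state z solves the equation with coefficient u and right-hand side
   - int phi grad y . grad v, which Hoelder's inequality bounds in the dual of
   W^{1,2} by ||phi||_r ||grad y||_s; its existence, uniqueness and bound are
   the state equation itself with fD = 0. The remainder d - z solves the same
   equation with grad d in place of grad y, so it is of size
   ||phi||_q ||grad d||_s, and it remains to see that grad d tends to 0 in L^s.
   Keep u + phi as the coefficient: then the right-hand side of the equation
   for d is - int phi grad y . grad v with the fixed function y, whence
   ||d||_{1,s} <= C ||phi grad y||_s by the bound of the state operator with
   exponent s. As |phi| <= uu a.e., the last norm tends to 0 with ||phi||_q,
   by dominated convergence. Thus no room between q and 2s/(s-2) is needed.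
   The feasible variations form a star-shaped set, so that the derivative is
   determined on them, and every derivative agrees there with phi |-> z. *)
Require Import Defs.
From HB Require Import structures.
From mathcomp Require Import all_boot all_order all_algebra.
From mathcomp Require Import all_classical all_reals all_analysis.
From mathcomp Require Import measurable_realfun ess_sup_inf lra ring.

Set Implicit Arguments.
Unset Strict Implicit.
Unset Printing Implicit Defensive.

Import Order.TTheory GRing.Theory Num.Theory.
Import numFieldNormedType.Exports.

Local Open Scope classical_set_scope.
Local Open Scope ring_scope.

(** * Lebesgue norms *)

Section lebesgue_spaces.
Context d (T : measurableType d) (R : realType).
Variable mu : {measure set T -> \bar R}.
Local Notation "''N_' p [ f ]" := (Lnorm mu p (EFin \o f)).
Implicit Types (f g : T -> R) (p r s : R).

Lemma le_poweR (x y : \bar R) p : 0 <= p -> (0 <= x)%E -> (x <= y)%E ->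
  (x `^ p <= y `^ p)%E.
Proof.
move=> p0 x0 xy; apply: gt0_ler_poweR => //; rewrite in_itv/= leey andbT//.
exact: le_trans xy.
Qed.

(* [filterS2] does not find the filter of the sets that are conull for
   [lebesgue_rV] and [surface_measure]. *)
Lemma ae_impl2 (P Q S : T -> Prop) : (forall x, P x -> Q x -> S x) ->
  (\forall x \ae mu, P x) -> (\forall x \ae mu, Q x) -> \forall x \ae mu, S x.
Proof. by move=> PQS aeP aeQ; apply: filterS2 aeP aeQ. Qed.

Lemma Rintegral0_eq (D : set T) f : (forall x, D x -> f x = 0) ->
  \int[mu]_(x in D) f x = 0.
Proof. by move=> f0; rewrite /Rintegral integral0_eq// => x /f0 ->. Qed.

Lemma Lfun_measurableP f (p : \bar R) :
  f \in Lfun mu p <-> measurable_fun setT f /\ ('N_p[f] < +oo)%E.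
Proof.
split; first by move=> /andP[]; rewrite !inE.
by move=> [mf lf]; apply/andP; rewrite !inE.
Qed.

Lemma Lfun_linear (p : \bar R) a f g : (1 <= p)%E ->
  f \in Lfun mu p -> g \in Lfun mu p -> a *: f + g \in Lfun mu p.
Proof. move=> p1 fp gp; exact: (Lfun_submod_closed mu p1).2. Qed.

Lemma Lfun_LnormZ (p : \bar R) a f : (1 <= p)%E -> f \in Lfun mu p ->
  ('N_p[(a *: f)%R] = `|a|%:E * 'N_p[f])%E.
Proof. by move=> p1 fp; rewrite -[f](Lfun_valP p1 fp) -LnormZ. Qed.

(** Replacing f by |f|^p divides the exponent by p. This reduces the inequality with 1/p = 1/r + 1/s
    to the conjugate exponents r/p and s/p. *)
Lemma Lnorm_normr_powR f p r : 0 < p -> 0 < r ->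
  ('N_(r / p)%:E[(fun x => `|f x| `^ p)%R] = 'N_r%:E[f] `^ p)%E.
Proof.
move=> p0 r0; have E : (r / p)^-1 = r^-1 * p by rewrite invf_div mulrC.
rewrite unlock -poweRrM E; apply: (congr1 (fun x => x `^ _)%E).
apply: eq_integral => x _ /=.
by rewrite ger0_norm ?powR_ge0// -powRrM (mulrC r) mulVKf// gt_eqF.
Qed.

Lemma measurable_normr_powR f p : measurable_fun setT f ->
  measurable_fun setT (fun x => `|f x| `^ p).
Proof.
move=> mf; apply: (@measurableT_comp _ _ _ _ _ _ (@powR R ^~ p)) => //.
exact: measurableT_comp.
Qed.

(** Hoelder's inequality with the conjugate exponents r/p and s/p, applied to |f|^p and |g|^p,
    followed by a p-th root. *)
Lemma hoelder_mul f g p r s : measurable_fun setT f -> measurable_fun setT g ->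
  0 < p -> 0 < r -> 0 < s -> p^-1 = r^-1 + s^-1 ->
  ('N_p%:E[(f \* g)%R] <= 'N_r%:E[f] * 'N_s%:E[g])%E.
Proof.
move=> mf mg p0 r0 s0 prs.
have -> : ('N_p%:E[(f \* g)%R] =
    'N_1[((fun x => `|f x| `^ p) \* (fun x => `|g x| `^ p))%R] `^ p^-1)%E.
  rewrite Lnorm1 unlock; congr (_ `^ _)%E; apply: eq_integral => x _ /=.
by rewrite normrM powRM// [in RHS]ger0_norm ?mulr_ge0 ?powR_ge0.
have H := @hoelder _ _ _ mu _ _ (r / p) (s / p)
  (measurable_normr_powR p mf) (measurable_normr_powR p mg).
have {}H := H (divr_gt0 r0 p0) (divr_gt0 s0 p0).
have {}H : ('N_1[((fun x => `|f x| `^ p) \* (fun x => `|g x| `^ p))%R]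
    <= 'N_r%:E[f] `^ p * 'N_s%:E[g] `^ p)%E.
  rewrite -!Lnorm_normr_powR//; apply: H.
  by rewrite !invf_div -mulrDr -prs mulfV// gt_eqF.
apply: (@le_trans _ _ ((('N_r%:E[f] `^ p * 'N_s%:E[g] `^ p) `^ p^-1)%E)).
  by apply: (le_poweR _ _ H); rewrite ?Lnorm_ge0 ?invr_ge0 ?ltW.
rewrite poweRM ?poweR_ge0// -!poweRrM mulfV ?gt_eqF// !poweRe1 ?Lnorm_ge0//.
Qed.

Lemma Lfun_mul f g p r s : 0 < p -> 0 < r -> 0 < s -> p^-1 = r^-1 + s^-1 ->
  f \in Lfun mu r%:E -> g \in Lfun mu s%:E -> f \* g \in Lfun mu p%:E.
Proof.
move=> p0 r0 s0 prs /Lfun_measurableP[mf Nf] /Lfun_measurableP[mg Ng].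
apply/Lfun_measurableP; split.
  exact: measurable_funM.
apply: le_lt_trans (hoelder_mul mf mg p0 r0 s0 prs) _.
by apply: lte_mul_pinfty; rewrite ?ge0_fin_numE ?Lnorm_ge0.
Qed.

Lemma normr_Rintegral_hoelder f g p q : 0 < p -> 0 < q -> 1 = p^-1 + q^-1 ->
  f \in Lfun mu p%:E -> g \in Lfun mu q%:E ->
  (`|\int[mu]_x (f x * g x)|%:E <= 'N_p%:E[f] * 'N_q%:E[g])%E.
Proof.
move=> p0 q0 pq fp gq.
have fg : f \* g \in Lfun mu 1.
  by apply: (@Lfun_mul f g 1 p q) => //; rewrite invr1.
have /Lfun1_integrable ifg := fg.
move: fp gq => /Lfun_measurableP[mf Nf] /Lfun_measurableP[mg Ng].
apply: (@le_trans _ _ 'N_1[(f \* g)%R]); last first.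
  by apply: hoelder_mul => //; rewrite invr1.
rewrite Lnorm1 EFin_normr_Rintegral//.
exact: (le_abse_integral mu measurableT (measurable_int mu ifg)).
Qed.

Lemma Lfun1_sum (I : Type) (l : seq I) (F : I -> T -> R) :
  (forall i, F i \in Lfun mu 1) -> (fun x => \sum_(i <- l) F i x) \in Lfun mu 1 /\
  \int[mu]_x (\sum_(i <- l) F i x) = \sum_(i <- l) \int[mu]_x F i x.
Proof.
move=> F1; elim: l => [|i l [IH1 IH2]].
  under eq_fun do rewrite big_nil.
  split; last by rewrite big_nil Rintegral_cst// mul0r.
  by apply/Lfun_measurableP; rewrite Lnorm0 ?onee_neq0.
have E : (fun x => \sum_(j <- i :: l) F j x) =
    (fun x => F i x + \sum_(j <- l) F j x).
  by apply/funext => x; rewrite big_cons.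
rewrite E; split.
  have := Lfun_linear 1 (lexx 1%E) (F1 i) IH1; rewrite scale1r; exact.
rewrite big_cons -IH2 RintegralD//; exact/Lfun1_integrable.
Qed.

Lemma ae_le_Lnormy f : \forall x \ae mu, (`|f x|%:E <= 'N_+oo[f])%E.
Proof.
rewrite unlock /Lnorm; case: ifPn => [mu0|]; first exact: ess_sup_ge.
(* The norm of exponent +oo is an essential supremum only if the space has positive measure;
   otherwise the whole space is the exceptional null set. *)
rewrite -leNgt => mu0; exists setT; split => //.
by apply/eqP; rewrite eq_le mu0 measure_ge0.
Qed.

Lemma ae_le_Lnorm f g p : 0 < p -> measurable_fun setT f ->
  measurable_fun setT g -> (\forall x \ae mu, `|f x| <= `|g x|) ->
  ('N_p%:E[f] <= 'N_p%:E[g])%E.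
Proof.
move=> p0 mf mg fg; rewrite unlock.
apply: le_poweR; first by rewrite invr_ge0 ltW.
  by apply: integral_ge0 => x _; exact: poweR_ge0.
apply: ae_ge0_le_integral => //.
- by move=> x _; exact: poweR_ge0.
- exact/measurable_EFinP/measurable_normr_powR.
- by move=> x _; exact: poweR_ge0.
- exact/measurable_EFinP/measurable_normr_powR.
- apply: filterS fg => x fg _; rewrite lee_fin.
  by rewrite ge0_ler_powR ?nnegrE// ltW.
Qed.

Lemma ae_eq_Lnorm f g p : 0 < p -> measurable_fun setT f ->
  measurable_fun setT g -> (\forall x \ae mu, f x = g x) ->
  'N_p%:E[f] = 'N_p%:E[g].
Proof.
move=> p0 mf mg fg; apply/eqP; rewrite eq_le !ae_le_Lnorm//.
  by apply: filterS fg => x ->.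
by apply: filterS fg => x ->.
Qed.

Lemma Lnorm_indic_finite D p : 0 < p -> measurable D -> (mu D < +oo)%E ->
  ('N_p%:E[\1_D : T -> R] < +oo)%E.
Proof.
move=> p0 mD muD; rewrite unlock poweR_lty//.
rewrite (eq_integral (EFin \o (\1_D : T -> R))) ?integral_indic//.
  by rewrite setIT.
move=> x _ /=; rewrite indicE; case: (x \in D).
- by rewrite normr1 powR1.
- by rewrite normr0 powR0 ?gt_eqF.
Qed.

(** As f = f 1_D, Hoelder's inequality against 1_D gives the constant ||1_D||_t with 1/r = 1/t +
    1/q. For q = +oo the function is dominated a.e. by ||f||_oo 1_D, and for q = r the constant is
    1. *)
Lemma Lnorm_le_finite_support D r (q : \bar R) : 0 < r -> (r%:E <= q)%E ->
  measurable D -> (mu D < +oo)%E ->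
  exists2 C : R, 0 <= C & forall f, measurable_fun setT f -> f \_ D = f ->
    ('N_q[f] < +oo)%E -> ('N_r%:E[f] <= C%:E * 'N_q[f])%E.
Proof.
move=> r0 rq mD muD.
have m1 : measurable_fun setT (\1_D : T -> R) by exact: measurable_indic.
have patchE f : f \_ D = f -> f = f \* (\1_D : T -> R).
  move=> fD; apply/funext => x; rewrite -{1}fD /= patchE indicE.
  by case: (x \in D); rewrite ?mulr1 ?mulr0.
case: q rq => [q | _ | //]; last first.
  exists (fine 'N_r%:E[\1_D : T -> R]); first by rewrite fine_ge0 ?Lnorm_ge0.
  move=> f mf fD fy; rewrite fineK; last first.
    by rewrite ge0_fin_numE ?Lnorm_ge0//; exact: Lnorm_indic_finite.
  set c := fine 'N_+oo[f].
  have cE : c%:E = 'N_+oo[f] by rewrite fineK// ge0_fin_numE ?Lnorm_ge0.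
  have c0 : 0 <= c by rewrite fine_ge0 ?Lnorm_ge0.
  apply: (@le_trans _ _ 'N_r%:E[(cst c \* \1_D)]).
    apply: ae_le_Lnorm => //; first exact: measurable_funM.
    apply: filterS (ae_le_Lnormy f) => x; rewrite -cE lee_fin => fc.
    rewrite {1}(patchE _ fD) /= !normrM (ger0_norm c0).
    exact: ler_wpM2r.
  rewrite -cE [in leLHS]unlock [in leRHS]unlock.
  under eq_integral => x _ do
    rewrite /= normrM (ger0_norm c0) powRM// EFinM.
  rewrite ge0_integralZl// ?lee_fin ?powR_ge0//; last first.
    exact/measurable_EFinP/measurable_normr_powR.
  rewrite poweRM ?lee_fin ?powR_ge0//; last first.
    by apply: integral_ge0 => x _; rewrite lee_fin powR_ge0.
  rewrite muleC poweR_EFin -powRrM mulfV ?gt_eqF// powRr1//.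
rewrite lee_fin le_eqVlt => /predU1P[<-|rq].
  by exists 1 => // f _ _ _; rewrite mul1e.
have q0 : 0 < q by exact: lt_trans rq.
pose t := (r^-1 - q^-1)^-1.
have t0 : 0 < t by rewrite invr_gt0 subr_gt0 ltf_pV2.
exists (fine 'N_t%:E[\1_D : T -> R]); first by rewrite fine_ge0 ?Lnorm_ge0.
move=> f mf fD fy; rewrite fineK; last first.
  by rewrite ge0_fin_numE ?Lnorm_ge0//; exact: Lnorm_indic_finite.
rewrite {1}(patchE _ fD) muleC; apply: hoelder_mul => //.
by rewrite invrK addrC subrK.
Qed.

Lemma ae_eq_of_Lnorm_sub f g (p : \bar R) : (0 < p)%E ->
  measurable_fun setT f -> measurable_fun setT g ->
  ('N_p[(f - g)%R] = 0)%E -> \forall x \ae mu, f x = g x.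
Proof.
move=> p0 mf mg /Lnorm_eq0_eq0.
have m : measurable_fun setT (EFin \o (f - g)).
  exact/measurable_EFinP/measurable_funB.
move=> /(_ m p0); apply: filterS => x /(_ I)/= [] /eqP.
by rewrite subr_eq0 => /eqP.
Qed.

Lemma Lfun_bounded_mul f g p (M : R) : 1 <= p -> 0 <= M ->
  measurable_fun setT f -> (\forall x \ae mu, `|f x| <= M) ->
  g \in Lfun mu p%:E -> f \* g \in Lfun mu p%:E.
Proof.
move=> p1 M0 mf fM gp; have /Lfun_measurableP[mg Ng] := gp.
have p0 : 0 < p by exact: lt_le_trans p1.
have mfg : measurable_fun setT (f \* g) by exact: measurable_funM.
apply/Lfun_measurableP; split => //.
have : (M *: g : T -> R) \in Lfun mu p%:E.
  have -> : (M *: g : T -> R) = M *: g + 0 by rewrite addr0.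
  apply: Lfun_linear => //; apply/Lfun_measurableP; split; first exact: measurable_cst.
  by rewrite (@Lnorm0 _ _ _ mu p%:E) ?ltry// eqe gt_eqF.
move=> /Lfun_measurableP[mMg]; apply: le_lt_trans; apply: ae_le_Lnorm => //.
apply: filterS fM => x fM; rewrite /= normrM [leRHS]normrM (ger0_norm M0).
exact: ler_wpM2r.
Qed.

Lemma measurable_truncated_powR g s (k : nat) : measurable_fun setT g ->
  measurable_fun setT (fun x => (`|g x| `^ s * (k%:R < `|g x|)%R%:R)%:E).
Proof.
move=> mg; apply/measurable_EFinP; apply: measurable_funM.
  exact: measurable_normr_powR.
have -> : (fun x => (k%:R < `|g x|)%R%:R) =
    (\1_[set x | k%:R < `|g x|] : T -> R).
  apply/funext => x; rewrite indicE; congr ((nat_of_bool _)%:R).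
  by apply/idP/idP; rewrite inE.
apply: measurable_indic; rewrite -[X in measurable X]setTI.
have -> : [set x | k%:R < `|g x|] = ((@Num.norm R R) \o g) @^-1` `]k%:R, +oo[%classic.
  by apply/seteqP; split => x /=; rewrite in_itv/= andbT.
by apply: (measurableT_comp (@normr_measurable _ _) mg).
Qed.

(** Dominated convergence with majorant |g|^s: at each point the integrand vanishes once k exceeds
    |g x|. *)
Lemma truncated_tail_cvg0 g s : measurable_fun setT g ->
  (\int[mu]_x (`|g x| `^ s)%:E < +oo)%E ->
  (\int[mu]_x (`|g x| `^ s * (k%:R < `|g x|)%R%:R)%:E)%E @[k --> \oo] --> 0%E.
Proof.
move=> mg ig.
have mk := measurable_truncated_powR s ^~ mg.
have := @dominated_cvg _ _ _ mu setT measurableT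
  (fun k x => (`|g x| `^ s * (k%:R < `|g x|)%R%:R)%:E) (cst 0%E)
  (fun x => (`|g x| `^ s)%:E) mk.
rewrite integral_cst// mul0e; apply.
- move=> x _; apply: cvg_near_cst; near=> k.
  suff -> : (k%:R < `|g x|) = false by rewrite mulr0.
  apply/negbTE; rewrite -leNgt; apply: ltW.
  near: k; exact: nbhs_infty_gtr.
- by [].
- apply/integrableP; split; first exact/measurable_EFinP/measurable_normr_powR.
  apply: le_lt_trans ig; rewrite le_eqVlt; apply/orP; left; apply/eqP.
  by apply: eq_integral => x _; rewrite gee0_abs// lee_fin powR_ge0.
- move=> k x _; rewrite abse_EFin lee_fin normrM ger0_norm ?powR_ge0//.
  by apply: ler_piMr; rewrite ?powR_ge0//; case: (_ < _); rewrite ?normr1 ?normr0.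
Unshelve. all: by end_near. Qed.

(* |f g|^s <= eta^s |g|^s + M^s k^s eta^(-r) |f|^r + M^s |g|^s 1_{|g| > k}:
   the first term counts where |f| <= eta, the second where |g| <= k. *)
Lemma Lnorm_mul_small g s r (M : R) : 0 < s -> 0 < r -> 0 <= M ->
  g \in Lfun mu s%:E -> forall eps : R, 0 < eps ->
  exists2 delta : R, 0 < delta & forall f, measurable_fun setT f ->
    (\forall x \ae mu, `|f x| <= M) -> ('N_r%:E[f] < delta%:E)%E ->
    ('N_s%:E[(f \* g)%R] <= eps%:E)%E.
Proof.
move=> s0 r0 M0 /Lfun_measurableP[mg Ng] eps eps0.
have ge0_G : (0 <= \int[mu]_x (`|g x| `^ s)%:E)%E.
  by apply: integral_ge0 => x _; rewrite lee_fin powR_ge0.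
have G_fin : (\int[mu]_x (`|g x| `^ s)%:E < +oo)%E.
  have := poweR_Lnorm mu (EFin \o g) (negbT (gt_eqF s0)).
  by move=> /= <-; exact: poweR_lty.
set G := fine (\int[mu]_x (`|g x| `^ s)%:E)%E.
have GE : (\int[mu]_x (`|g x| `^ s)%:E = G%:E)%E by rewrite fineK// ge0_fin_numE.
have G0 : 0 <= G by rewrite fine_ge0.
(* One third of the target for each of the three integrals. *)
pose e := eps `^ s / 3.
have e0 : 0 < e by rewrite divr_gt0// powR_gt0.
(* Chosen so that eta^s G <= e. The 1 added to G, and below to m and B, keeps the quotient positive
   and the bound valid when the constant is 0. *)
pose eta := (e / (G + 1)) `^ s^-1.
have eta0 : 0 < eta by rewrite powR_gt0// divr_gt0// ltr_wpDl.
have etaG : eta `^ s * G <= e.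
  rewrite -powRrM mulVf ?gt_eqF// powRr1; last by rewrite divr_ge0 ?ltW// ltr_wpDl.
  by rewrite mulrAC ler_pdivrMr ?ltr_wpDl// ler_pM2l// lerDl.
pose m := M `^ s.
have m0 : 0 <= m by rewrite powR_ge0.
have [k Hk] : exists k : nat,
    (\int[mu]_x (`|g x| `^ s * (k%:R < `|g x|)%R%:R)%:E <= (e / (m + 1))%:E)%E.
  have e1 : 0 < e / (m + 1) by rewrite divr_gt0// ltr_wpDl.
  have /fine_cvgP[fin /cvgr_lt/(_ _ e1) lt] := truncated_tail_cvg0 mg G_fin.
  have [k [kfin klt]] := filter_ex (filterI fin lt).
  by exists k; rewrite -(fineK kfin) lee_fin ltW.
pose B := m * k%:R `^ s * eta `^ (- r).
have B0 : 0 <= B by rewrite !mulr_ge0 ?powR_ge0.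
pose delta := (e / (B + 1)) `^ r^-1.
have delta0 : 0 < delta by rewrite powR_gt0// divr_gt0// ltr_wpDl.
exists delta => // f mf fM Nf.
have If : (\int[mu]_x (`|f x| `^ r)%:E <= (e / (B + 1))%:E)%E.
  have := poweR_Lnorm mu (EFin \o f) (negbT (gt_eqF r0)).
  move=> /= <-; apply: le_trans (le_poweR (ltW r0) (Lnorm_ge0 _ _ _) (ltW Nf)) _.
  rewrite poweR_EFin lee_fin -powRrM mulVf ?gt_eqF// powRr1//.
  by rewrite divr_ge0 ?ltW// ltr_wpDl.
suff H : (\int[mu]_x (`|f x * g x| `^ s)%:E <= (eps `^ s)%:E)%E.
  rewrite unlock; apply: (@le_trans _ _ ((eps `^ s)%:E `^ s^-1)%E).
    apply: le_poweR; [by rewrite invr_ge0 ltW| |exact: H].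
    by apply: integral_ge0 => x _; rewrite poweR_ge0.
  by rewrite poweR_EFin -powRrM mulfV ?gt_eqF// powRr1// ltW.
have mgs : measurable_fun setT (fun x => (`|g x| `^ s)%:E).
  exact/measurable_EFinP/measurable_normr_powR.
have mfr : measurable_fun setT (fun x => (`|f x| `^ r)%:E).
  exact/measurable_EFinP/measurable_normr_powR.
have mtail := measurable_truncated_powR s k mg.
apply: (@le_trans _ _ (\int[mu]_x ((eta `^ s)%:E * (`|g x| `^ s)%:E +
  B%:E * (`|f x| `^ r)%:E +
  m%:E * (`|g x| `^ s * (k%:R < `|g x|)%R%:R)%:E))%E).
  apply: ae_ge0_le_integral => //.
  - apply/measurable_EFinP/measurable_normr_powR; exact: measurable_funM.
  - by move=> x _; rewrite -!EFinM -!EFinD lee_fin !addr_ge0// ?mulr_ge0// ?powR_ge0.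
  - apply: emeasurable_funD; first apply: emeasurable_funD.
    + exact: measurable_funeM.
    + exact: measurable_funeM.
    + exact: measurable_funeM.
  apply: filterS fM => x fM _; rewrite -!EFinM -!EFinD lee_fin.
  have [fe|fe] := leP `|f x| eta.
    rewrite -addrA ler_wpDr ?addr_ge0 ?mulr_ge0 ?powR_ge0//.
    rewrite normrM powRM// ler_wpM2r ?powR_ge0//.
    by rewrite ge0_ler_powR// ?nnegrE ltW.
  have fgM : `|f x * g x| `^ s <= m * `|g x| `^ s.
    rewrite normrM powRM// ler_wpM2r ?powR_ge0//.
    by rewrite ge0_ler_powR// ?nnegrE ltW.
  have [gk|gk] := ltP k%:R `|g x|.
    by rewrite mulr1 ler_wpDl ?addr_ge0 ?mulr_ge0 ?powR_ge0.
  (* Here eta < |f| and |g| <= k, so that 1 <= eta^(-r) |f|^r and the middle term alone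
     dominates. *)
  rewrite !mulr0 addr0 ler_wpDl ?mulr_ge0 ?powR_ge0//; apply: le_trans fgM _.
  rewrite /B -!mulrA ler_wpM2l//.
  apply: (@le_trans _ _ (k%:R `^ s)).
    by rewrite ge0_ler_powR ?nnegrE// ltW.
  apply: ler_peMr; first exact: powR_ge0.
  rewrite powRN mulrC.
  have eta_r : 0 < eta `^ r by exact: powR_gt0.
  rewrite (ler_pdivlMr _ _ eta_r) mul1r.
  by rewrite ge0_ler_powR ?nnegrE// ltW.
rewrite ge0_integralD//; last 4 first.
- by move=> x _; rewrite -!EFinM -!EFinD lee_fin !addr_ge0// ?mulr_ge0// ?powR_ge0.
- by apply: emeasurable_funD; exact: measurable_funeM.
- by move=> x _; rewrite -!EFinM lee_fin !mulr_ge0// ?powR_ge0.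
- exact: measurable_funeM.
rewrite ge0_integralD//; last 4 first.
- by move=> x _; rewrite -!EFinM lee_fin !mulr_ge0// ?powR_ge0.
- exact: measurable_funeM.
- by move=> x _; rewrite -!EFinM lee_fin !mulr_ge0// ?powR_ge0.
- exact: measurable_funeM.
rewrite !ge0_integralZl ?lee_fin ?powR_ge0//.
have aux c : 0 <= c -> c * (e / (c + 1)) <= e.
  move=> c0; rewrite mulrA ler_pdivrMr ?ltr_wpDl// mulrDr mulr1 mulrC lerDl.
  exact: ltW.
have -> : eps `^ s = e + e + e by rewrite /e; field.
rewrite !EFinD GE; apply: leeD; first apply: leeD.
- by rewrite -EFinM lee_fin.
- apply: le_trans (lee_wpmul2l _ If) _; first by rewrite lee_fin.
  by rewrite -EFinM lee_fin aux.
- apply: le_trans (lee_wpmul2l _ Hk) _; first by rewrite lee_fin.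
  by rewrite -EFinM lee_fin aux.
Qed.

End lebesgue_spaces.

(** * Borel sets of R^d are Lebesgue measurable *)

Section lebesgue_borel.
Context (R : realType) (n : nat).
Local Notation V := 'rV[R]_n.+1.
Local Notation lout := (@lebesgue_outer R n).
Local Notation leb := (@lebesgue_rV R n).

Lemma lebesgue_outer_le (A : set V) : (lout A <= box_volume A)%E.
Proof.
apply: ereal_inf_lbound; exists (fun k => if k == 0%N then A else set0).
  by move=> x Ax; exists 0%N.
apply/lim_near_cst => //; near=> k.
have -> : k = k.-1.+1 by rewrite prednK//; near: k; exact: nbhs_infty_gt.
rewrite big_nat_recl//= big1 ?adde0// => i _; exact: box_volume0.
Unshelve. all: by end_near. Qed.

Definition set_coord (a : V) (i : 'I_n.+1) (m : R) : V :=
  \row_j (if j == i then m else a ord0 j).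

(* A box cut by a half-space is two boxes whose volumes add up. *)
Lemma lebesgue_outer_box_split (A : set V) (i : 'I_n.+1) (c : R) :
  (lout (A `&` [set x | (x ord0 i <= c)%R]) +
   lout (A `&` ~` [set x | (x ord0 i <= c)%R]) <= box_volume A)%E.
Proof.
apply: le_ereal_inf_tmp => _ [[a b] /= [ab ->] <-].
(* The cutting value c clamped to the i-th side of the box; if c lies outside that side, one of the
   two pieces is degenerate but still a box. *)
pose m := Num.max (a ord0 i) (Num.min (b ord0 i) c).
have abi := ab i.
have am : a ord0 i <= m by rewrite /m le_max lexx.
have mb : m <= b ord0 i by rewrite /m ge_max abi ge_min lexx.
have E1 : box a b `&` [set x | (x ord0 i <= c)%R] = box a (set_coord b i m).
  apply/seteqP; split => x /=.
    move=> [xab xc] j; rewrite mxE; have := xab j; case: eqP => // ->.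
    by rewrite /m le_max le_min xc => /andP[-> ->]; rewrite orbT.
  move=> xab; have := xab i; rewrite mxE eqxx /m le_max => /andP[axi].
  rewrite leNgt axi/= le_min => /andP[xb xc]; split => // j.
  by have := xab j; rewrite mxE; case: eqP => // ->; rewrite axi.
have E2 : box a b `&` ~` [set x | (x ord0 i <= c)%R] = box (set_coord a i m) b.
  apply/seteqP; split => x /=.
    move=> [xab /negP]; rewrite -ltNge => cx j; rewrite mxE; have := xab j.
    case: eqP => // -> /andP[ax xb].
    by rewrite xb andbT /m gt_max ax gt_min cx orbT.
  move=> xab; have := xab i; rewrite mxE eqxx /m gt_max => /andP[/andP[axi]].
  rewrite gt_min ltNge => /[swap] xb; rewrite xb/= => cx.
  split; last by apply/negP; rewrite -ltNge.
  by move=> j; have := xab j; rewrite mxE; case: eqP => // ->; rewrite axi xb.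
rewrite E1 E2; apply: (@le_trans _ _
  ((\prod_j (set_coord b i m ord0 j - a ord0 j))%:E +
   (\prod_j (b ord0 j - set_coord a i m ord0 j))%:E)%E).
  apply: leeD; apply: le_trans (lebesgue_outer_le _) _; apply: ereal_inf_lbound.
    exists (a, set_coord b i m) => //=; split => // j.
    by rewrite mxE; case: eqP => // ->.
  exists (set_coord a i m, b) => //=; split => // j.
  by rewrite mxE; case: eqP => // ->.
rewrite -EFinD lee_fin (bigD1 i)//= mxE eqxx.
rewrite [X in _ + X <= _](bigD1 i)//= mxE eqxx [leRHS](bigD1 i)//=.
rewrite (eq_bigr (fun j => b ord0 j - a ord0 j)); last first.
  by move=> j /negbTE ji; rewrite mxE ji.
rewrite [X in _ + _ * X <= _](eq_bigr (fun j => b ord0 j - a ord0 j)); last first.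
  by move=> j /negbTE ji; rewrite mxE ji.
by rewrite -mulrDl addrC subrKA.
Qed.

Local Notation cara := (caratheodory_type lout).

(** Caratheodory's criterion, tested on a cover F of X: the pieces of each F k on the two sides of
    the hyperplane have outer measures of sum at most the volume of F k. Summation over k and the
    infimum over the covers give the inequality for X. *)
Lemma measurable_halfspace (i : 'I_n.+1) (c : R) :
  measurable ([set x : V | x ord0 i <= c] : set cara).
Proof.
apply: le_caratheodory_measurable => X; set H := [set x | _].
apply: le_ereal_inf_tmp => _ [F XF <-].
have sub B : (lout (X `&` B) <= \sum_(k <oo) lout (F k `&` B))%E.
  apply: le_trans (outer_measure_sigma_subadditive lout _).
  apply: le_outer_measure; rewrite -setI_bigcupl; exact: setSI.
apply: le_trans (leeD (sub _) (sub _)) _.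
rewrite -nneseriesD//; do ?by move=> *; exact: outer_measure_ge0.
apply: lee_nneseries => k *.
  by apply: adde_ge0; exact: outer_measure_ge0.
exact: lebesgue_outer_box_split.
Qed.

Lemma measurable_box (a b : V) : measurable (box a b : set cara).
Proof.
have -> : box a b = \bigcap_(i : 'I_n.+1) ([set x : V | x ord0 i <= b ord0 i] `\`
    [set x : V | x ord0 i <= a ord0 i]).
  apply/seteqP; split => x /=.
    by move=> xab i _; have /andP[ax xb] := xab i; split => //; apply/negP; rewrite -ltNge.
  by move=> xab i; have [/= -> /negP] := xab i I; rewrite -ltNge => ->.
apply: fin_bigcap_measurable => // i _.
by apply: measurableD; exact: measurable_halfspace.
Qed.

(** An open set is the union of the boxes with rational corners that it contains, and there are
    countably many of these. A point x of U lies in such a box because the norm is the maximum norm: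
    rational coordinates within e on both sides of x suffice. *)
Lemma open_measurable_rV (U : set V) : open U -> measurable (U : set cara).
Proof.
move=> oU.
pose rv (a : 'rV[rat]_n.+1) : V := map_mx ratr a.
pose F (ab : 'rV[rat]_n.+1 * 'rV[rat]_n.+1) : set cara :=
  if `[< box (rv ab.1) (rv ab.2) `<=` U >] then box (rv ab.1) (rv ab.2) else set0.
have -> : U = \bigcup_ab F ab.
  apply/seteqP; split => x; last first.
    by move=> [ab _]; rewrite /F; case: asboolP => [H /H|].
  move=> Ux; have /nbhs_ballP[e /= e0 xeU] : nbhs x U by exact: open_nbhs_nbhs.
  have /choice[a Ha] : forall j, exists q : rat, x ord0 j - e < ratr q < x ord0 j.
    move=> j; have [|q] := @rat_in_itvoo R (x ord0 j - e) (x ord0 j).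
      by rewrite ltrBlDr ltrDl.
    by rewrite in_itv/= => qx; exists q.
  have /choice[b Hb] : forall j, exists q : rat, x ord0 j < ratr q < x ord0 j + e.
    move=> j; have [|q] := @rat_in_itvoo R (x ord0 j) (x ord0 j + e).
      by rewrite ltrDl.
    by rewrite in_itv/= => qx; exists q.
  exists (\row_j a j, \row_j b j) => //; rewrite /F; case: asboolP.
    by move=> _ j; rewrite !mxE; have /andP[_ ->] := Ha j; have /andP[/ltW ->] := Hb j.
  case=> y /= yab; apply: xeU; split => // i j; rewrite ord1.
  have := yab j; rewrite !mxE => /andP[y1 y2].
  have /andP[a1 a2] := Ha j; have /andP[b1 b2] := Hb j.
  rewrite /ball/= ltr_distlC; apply/andP; split; [exact: lt_trans y1|].
  exact: le_lt_trans b2.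
apply: countable_bigcupT_measurable; first exact: countableP.
by move=> ab; rewrite /F; case: asboolP => _; [exact: measurable_box|exact: measurable0].
Qed.

Lemma continuous_measurable_rV (f : V -> R) : continuous f ->
  measurable_fun setT (f : cara -> R).
Proof.
move=> /continuousP cf; apply: (measurability _ (RGenOpens.measurableE R)).
move=> _ [_ [a [b ->] <-]]; rewrite setTI; apply: open_measurable_rV.
apply: cf; exact: interval_open.
Qed.

Lemma bounded_lebesgue_finite (A : set V) : bounded_set A -> (leb A < +oo)%E.
Proof.
move=> [M [_ /(_ (M + 1))]]; rewrite ltrDl => /(_ ltr01) AM.
pose N : R := `|M + 1|.
(* Boxes are open on the left, so the lower corner has to lie strictly below -N. *)
have AN : A `<=` box (const_mx (- N - 1)) (const_mx N).
  move=> x /AM xM i; rewrite !mxE.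
  have : `|x ord0 i| <= N.
    apply: le_trans (ler_norm _); apply: le_trans xM.
    rewrite -[`|x|]/(mx_norm x) mx_normrE.
    exact: (le_bigmax _ (fun ij : 'I_1 * 'I_n.+1 => `|x ij.1 ij.2|) (ord0, i)).
  by rewrite ler_norml => /andP[Nx ->]; rewrite andbT ltrBlDr ltr_pwDr.
apply: le_lt_trans (le_outer_measure lout _ _ AN) _.
apply: le_lt_trans (lebesgue_outer_le _) _.
apply: (@le_lt_trans _ _ (\prod_(i < n.+1)
    ((const_mx N : V) ord0 i - (const_mx (- N - 1) : V) ord0 i))%:E).
  apply: ereal_inf_lbound; exists (const_mx (- N - 1), const_mx N) => //=.
  split => // i; rewrite !mxE.
  by have := normr_ge0 (M + 1); rewrite -/N; lra.
by rewrite ltry.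
Qed.

End lebesgue_borel.

(** * Algebra of extension by zero *)

Section restriction.
Context {T : Type} {R : realType}.
Implicit Types (f g : T -> R) (D : set T).

Lemma restrict_linear D (a : R) f g :
  (a *: f + g) \_ D = a *: (f \_ D) + (g \_ D) :> (T -> R).
Proof.
apply/funext => x; transitivity (a * (f \_ D) x + (g \_ D) x); last by [].
by rewrite !patchE; case: ifP => // _; rewrite mulr0 addr0.
Qed.

Lemma restrictM D f g : (f \* g) \_ D = (f \_ D) \* (g \_ D) :> (T -> R).
Proof. by apply/funext => x /=; rewrite !patchE; case: ifP; rewrite ?mulr0. Qed.

Lemma restrict0 D : (0 : T -> R) \_ D = 0 :> (T -> R).
Proof. by apply/funext => x /=; rewrite !patchE; case: ifP. Qed.

Lemma restrict_id D f : (f \_ D) \_ D = f \_ D :> (T -> R).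
Proof. by apply/funext => x; rewrite !patchE; case: ifP => // ->. Qed.

Lemma restrict_sum D (I : Type) (l : seq I) (F : I -> T -> R) :
  (fun x => \sum_(i <- l) F i x) \_ D = (fun x => \sum_(i <- l) (F i \_ D) x).
Proof.
apply/funext => x; under [RHS]eq_bigr do rewrite patchE.
by rewrite patchE; case: ifP => // _; rewrite big1.
Qed.

End restriction.

(** * Lebesgue spaces on a subset, through extension by zero *)

Section lebesgue_spaces_on_domain.
Context {R : realType} {n : nat}.
Local Notation V := 'rV[R]_n.+2.
Local Notation I := 'I_n.+2.
Local Notation leb := (@lebesgue_rV R n.+1).
Local Notation surf := (@surface_measure R n).
Variable Omega : set V.
Implicit Types (f g : V -> R) (p q r s a : R) (v w : @sob R n).

Lemma LpP f (p : \bar R) : Lp Omega p f <->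
  measurable_fun setT (f \_ Omega : caratheodory_type (@lebesgue_outer R n.+1) -> R) /\
  (Lp_norm Omega p f < +oo)%E.
Proof. exact: Lfun_measurableP. Qed.

Lemma Lp_linear (p : \bar R) a f g : (1 <= p)%E ->
  Lp Omega p f -> Lp Omega p g -> Lp Omega p (a *: f + g).
Proof. by move=> p1 fp gp; rewrite /Lp/= restrict_linear; exact: Lfun_linear. Qed.

Lemma Lp0 (p : \bar R) : (1 <= p)%E -> Lp Omega p 0.
Proof.
move=> p1; apply/LpP; rewrite /Lp_norm restrict0; split.
  exact: measurable_cst.
by rewrite (@Lnorm0 _ _ _ _ p) ?ltry// gt_eqF// (lt_le_trans _ p1).
Qed.

Lemma Lp_normZ (p : \bar R) a f : (1 <= p)%E -> Lp Omega p f ->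
  (Lp_norm Omega p (a *: f)%R = `|a|%:E * Lp_norm Omega p f)%E.
Proof.
move=> p1 fp; have -> : a *: f = a *: f + 0 by rewrite addr0.
rewrite /Lp_norm restrict_linear restrict0 addr0.
exact: Lfun_LnormZ.
Qed.

Lemma Lp_norm0 (p : \bar R) : (1 <= p)%E -> Lp_norm Omega p 0 = 0%E.
Proof.
move=> p1; rewrite /Lp_norm restrict0.
by rewrite (@Lnorm0 _ _ _ _ p)// gt_eqF// (lt_le_trans _ p1).
Qed.

Lemma le_Lp_normD (p : \bar R) f g : (1 <= p)%E -> Lp Omega p f -> Lp Omega p g ->
  (Lp_norm Omega p (f + g)%R <= Lp_norm Omega p f + Lp_norm Omega p g)%E.
Proof.
move=> p1 /LpP[mf _] /LpP[mg _]; rewrite /Lp_norm.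
have -> : f + g = 1 *: f + g by rewrite scale1r.
rewrite restrict_linear scale1r; exact: eminkowski.
Qed.

Lemma Lp_norm_ge0 (p : \bar R) f : (0 <= Lp_norm Omega p f)%E.
Proof. exact: Lnorm_ge0. Qed.

Lemma Lp_mul f g p r s : 0 < p -> 0 < r -> 0 < s -> p^-1 = r^-1 + s^-1 ->
  Lp Omega r%:E f -> Lp Omega s%:E g -> Lp Omega p%:E (f \* g).
Proof.
by move=> p0 r0 s0 prs fr gs; rewrite /Lp/= restrictM; exact: Lfun_mul fr gs.
Qed.

Lemma le_Lp_norm_mul f g p r s : 0 < p -> 0 < r -> 0 < s -> p^-1 = r^-1 + s^-1 ->
  Lp Omega r%:E f -> Lp Omega s%:E g ->
  (Lp_norm Omega p%:E (f \* g)%R <= Lp_norm Omega r%:E f * Lp_norm Omega s%:E g)%E.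
Proof.
move=> p0 r0 s0 prs /LpP[mf _] /LpP[mg _].
by rewrite /Lp_norm restrictM; exact: hoelder_mul.
Qed.

(** Membership in L^oo with the bound made explicit, since one bound has to serve all admissible
    coefficients and all feasible variations at once. *)
Definition ae_bounded f (M : R) : Prop :=
  measurable_fun setT (f \_ Omega : caratheodory_type (@lebesgue_outer R n.+1) -> R) /\
  \forall x \ae leb, `|(f \_ Omega) x| <= M.

Lemma Lp_bounded_mul f g p (M : R) : 1 <= p -> 0 <= M -> ae_bounded f M ->
  Lp Omega p%:E g -> Lp Omega p%:E (f \* g).
Proof.
move=> p1 M0 [mf fM] gp; rewrite /Lp/= restrictM.
exact: (Lfun_bounded_mul p1 M0).
Qed.

Lemma Lp_norm_mul_small g s r (M : R) : 0 < s -> 0 < r -> 0 <= M ->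
  Lp Omega s%:E g -> forall eps : R, 0 < eps ->
  exists2 delta : R, 0 < delta & forall f, ae_bounded f M ->
    (Lp_norm Omega r%:E f < delta%:E)%E ->
    (Lp_norm Omega s%:E (f \* g)%R <= eps%:E)%E.
Proof.
move=> s0 r0 M0 gs eps eps0.
have [delta delta0 H] := Lnorm_mul_small s0 r0 M0 gs eps0.
exists delta => // f [mf fM] Nf; rewrite /Lp_norm restrictM; exact: H.
Qed.

Lemma ae_eq_of_Lp_norm_sub f g (p : \bar R) : (1 <= p)%E ->
  Lp Omega p f -> Lp Omega p g -> Lp_norm Omega p (f - g) = 0%E ->
  \forall x \ae leb, (f \_ Omega) x = (g \_ Omega) x.
Proof.
move=> p1 /LpP[mf _] /LpP[mg _] fg.
apply: (@ae_eq_of_Lnorm_sub _ _ _ _ _ _ p) => //.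
  exact: lt_le_trans p1.
rewrite -fg /Lp_norm; have -> : f - g = -1 *: g + f by rewrite scaleN1r addrC.
by rewrite restrict_linear scaleN1r addrC.
Qed.

Hypothesis mOmega :
  measurable (Omega : set (caratheodory_type (@lebesgue_outer R n.+1))).

Lemma Lp_norm_le_finite r (q : \bar R) : 1 <= r -> (r%:E <= q)%E ->
  (leb Omega < +oo)%E ->
  exists2 C : R, 0 <= C & forall f, Lp Omega q f -> Lp Omega r%:E f /\
    (Lp_norm Omega r%:E f <= C%:E * Lp_norm Omega q f)%E.
Proof.
move=> r1 rq fO; have r0 : 0 < r by exact: lt_le_trans r1.
have [C C0 H] := Lnorm_le_finite_support r0 rq mOmega fO.
exists C => // f /LpP[mf Nf].
have E : (Lp_norm Omega r%:E f <= C%:E * Lp_norm Omega q f)%E.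
  by apply: H => //; rewrite restrict_id.
split=> //; apply/LpP; split => //; apply: le_lt_trans E _.
by apply: lte_mul_pinfty; rewrite ?lee_fin.
Qed.

Lemma Rintegral_Lp1_linear a f g : Lp Omega 1 f -> Lp Omega 1 g ->
  \int[leb]_(x in Omega) (a * f x + g x) =
  a * \int[leb]_(x in Omega) f x + \int[leb]_(x in Omega) g x.
Proof.
move=> /Lfun1_integrable if1 /Lfun1_integrable ig1.
have fO : leb.-integrable Omega (EFin \o f).
  by apply/integrable_mkcond => //; rewrite restrict_comp.
have gO : leb.-integrable Omega (EFin \o g).
  by apply/integrable_mkcond => //; rewrite restrict_comp.
rewrite RintegralD//; first by rewrite RintegralZl.
exact: (integrableZl mOmega a fO).
Qed.

End lebesgue_spaces_on_domain.

(** * Sobolev spaces and traces *)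

Section smooth_functions.
Context {R : realType} {n : nat}.
Local Notation V := 'rV[R]_n.+1.
Implicit Types (f g : V -> R) (i : 'I_n.+1).

Lemma pderiv_linear i (a : R) f g :
  (forall x, derivable f x (basis_vec i)) ->
  (forall x, derivable g x (basis_vec i)) ->
  pderiv i (a *: f + g) = a *: pderiv i f + pderiv i g.
Proof.
move=> df dg; apply/funext => x; rewrite /pderiv.
by rewrite deriveD ?deriveZ//; exact: derivableZ.
Qed.

Lemma smooth_linear (a : R) f g : smooth f -> smooth g -> smooth (a *: f + g).
Proof.
move=> sf sg l.
suff -> : foldr pderiv (a *: f + g) l = a *: foldr pderiv f l + foldr pderiv g l.
  have [cf df] := sf l; have [cg dg] := sg l; split.
    by move=> x; exact: (cvgD (cvgZl_tmp (k := a) (cf x)) (cg x)).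
  by move=> i x; apply: derivableD => //; exact: derivableZ.
elim: l => //= i l ->; rewrite pderiv_linear//.
  by move=> x; exact: (sf l).2.
by move=> x; exact: (sg l).2.
Qed.

Lemma smooth0 : smooth (0 : V -> R).
Proof.
have p0 i : pderiv i (0 : V -> R) = 0.
  by apply/funext => x; rewrite /pderiv; exact: derive_cst.
move=> l; have -> : foldr pderiv (0 : V -> R) l = 0 by elim: l => //= i l ->.
by split => [|i x]; [exact: cst_continuous|exact: derivable_cst].
Qed.

(** The complement of the closed support is open, so f agrees with 0 near x. *)
Lemma pderiv_out_support i f x : ~ closure [set y | f y != 0] x ->
  pderiv i f x = 0.
Proof.
move=> xK; have <- : pderiv i (cst 0 : V -> R) x = 0 by exact: derive_cst.
apply: near_eq_derive.
have : (~` closure [set y | f y != 0]) x by [].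
have /open_nbhs_nbhs H : open_nbhs x (~` closure [set y | f y != 0]).
  by split => //; apply: closed_openC; exact: closed_closure.
move=> _; apply: filterS H => y yK; apply/eqP/negPn/negP => fy.
by apply: yK; exact: subset_closure.
Qed.

(** Here g stands for the test function f or for one of its derivatives: it is bounded on the
    compact support and 0 off it. *)
Lemma compactly_supported_bounded Omega f g : continuous g ->
  (forall x, ~ closure [set y | f y != 0] x -> g x = 0) ->
  compactly_supported_in Omega f -> exists M, forall x, `|g x| <= M.
Proof.
move=> cg g0 [cK _]; set K := closure _ in cK.
have : compact (g @` K).
  by apply: continuous_compact => //; exact: continuous_subspaceT.
move=> /compact_bounded[M [_ /(_ (M + 1))]]; rewrite ltrDl => /(_ ltr01) HM.
exists `|M + 1| => x; have [xK|xK] := pselect (K x).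
  by apply: le_trans (ler_norm _); apply: HM; exists x.
by rewrite g0// normr0.
Qed.

End smooth_functions.

Section sobolev.
Context {R : realType} {n : nat}.
Local Notation V := 'rV[R]_n.+2.
Local Notation I := 'I_n.+2.
Local Notation leb := (@lebesgue_rV R n.+1).
Local Notation surf := (@surface_measure R n).
Variable Omega : set V.
Hypothesis mOmega :
  measurable (Omega : set (caratheodory_type (@lebesgue_outer R n.+1))).
Hypothesis fOmega : (leb Omega < +oo)%E.
Implicit Types (f g : V -> R) (p q r s a : R) (v w : @sob R n).

(** This makes the integrals in the definition of the weak gradient finite, so that they may be
    split: f is integrable because [Omega] has finite measure, and g is a bounded test function or
    derivative. *)
Lemma Lp1_bounded_continuous_mul f g p (M : R) : 1 <= p -> Lp Omega p%:E f ->
  continuous g -> (forall x, `|g x| <= M) -> Lp Omega 1 (f \* g).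
Proof.
move=> p1 fp cg gM.
have [C _ H] := Lp_norm_le_finite mOmega (lexx 1) (p1 : (1%:E <= p%:E)%E) fOmega.
have {H}[f1 _] := H _ fp.
have M0 : 0 <= M by apply: le_trans (gM 0).
have -> : f \* g = g \* f by apply/funext => x; exact: mulrC.
(* Only f is cut off, so that g stays continuous, hence measurable, on the whole space. *)
rewrite /Lp/=; have -> : (g \* f) \_ Omega = g \* (f \_ Omega).
  by apply/funext => x /=; rewrite !patchE; case: ifP; rewrite ?mulr0.
apply: (Lfun_bounded_mul (lexx _) M0 _ _ f1).
  exact: continuous_measurable_rV.
exact: nearW.
Qed.

Lemma sob_linear1 a v w : (a *: v + w).1 = a *: v.1 + w.1.
Proof. by []. Qed.

Lemma sob_linear2 a v w i : (a *: v + w).2 i = a *: v.2 i + w.2 i.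
Proof. by []. Qed.

Lemma W1_linear p a v w : 1 <= p -> W1 Omega p v -> W1 Omega p w ->
  W1 Omega p (a *: v + w).
Proof.
move=> p1 [v1 v2 v3] [w1 w2 w3]; split.
- by rewrite sob_linear1; exact: Lp_linear.
- by move=> i; rewrite sob_linear2; exact: Lp_linear.
- move=> phi i sphi cphi.
  have cd : continuous (pderiv i phi) by exact: (sphi [:: i]).1.
  have c0 : continuous phi by exact: (sphi [::]).1.
  have [M HM] := compactly_supported_bounded cd (@pderiv_out_support _ _ i phi) cphi.
  have [N HN] : exists N, forall x, `|phi x| <= N.
    apply: (compactly_supported_bounded c0 _ cphi) => x xK.
    by apply/eqP/negPn/negP => fx; apply: xK; exact: subset_closure.
  transitivity (\int[leb]_(x in Omega)
      (a * (v.1 x * pderiv i phi x) + w.1 x * pderiv i phi x)).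
    by apply: eq_Rintegral => x _; rewrite mulrA -mulrDl.
  have /= -> := Rintegral_Lp1_linear mOmega a
    (Lp1_bounded_continuous_mul p1 v1 cd HM) (Lp1_bounded_continuous_mul p1 w1 cd HM).
  rewrite v3// w3// mulrN -opprD; congr (- _).
  have /= <- := Rintegral_Lp1_linear mOmega a
    (Lp1_bounded_continuous_mul p1 (v2 i) c0 HN) (Lp1_bounded_continuous_mul p1 (w2 i) c0 HN).
  by apply: eq_Rintegral => x _; rewrite mulrA -mulrDl.
Qed.

Lemma W1_0 p : 1 <= p -> W1 Omega p 0.
Proof.
move=> p1; split; first exact: Lp0.
  by move=> i; exact: Lp0.
move=> phi i _ _.
under eq_Rintegral do rewrite mul0r.
under [in RHS]eq_Rintegral do rewrite mul0r.
by rewrite Rintegral_cst// mul0r oppr0.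
Qed.

Lemma W1_normZ p a w : 1 <= p -> W1 Omega p w ->
  (W1_norm Omega p (a *: w)%R = `|a|%:E * W1_norm Omega p w)%E.
Proof.
move=> p1 [w1 w2 _]; rewrite /W1_norm ge0_muleDr ?Lp_norm_ge0//; last first.
  by apply: sume_ge0 => i _; exact: Lp_norm_ge0.
rewrite ge0_sume_distrr; last by move=> i _; exact: Lp_norm_ge0.
congr (_ + _)%E; first exact: (Lp_normZ a _ w1).
by apply: eq_bigr => i _; exact: (Lp_normZ a _ (w2 i)).
Qed.

Lemma le_W1_normD p v w : 1 <= p -> W1 Omega p v -> W1 Omega p w ->
  (W1_norm Omega p (v + w)%R <= W1_norm Omega p v + W1_norm Omega p w)%E.
Proof.
move=> p1 [v1 v2 _] [w1 w2 _]; rewrite /W1_norm addeACA -big_split/=.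
apply: leeD; first exact: le_Lp_normD.
by apply: lee_sum => i _; exact: le_Lp_normD.
Qed.

Lemma W1_norm_ge0 p w : (0 <= W1_norm Omega p w)%E.
Proof.
by apply: adde_ge0; [exact: Lp_norm_ge0|apply: sume_ge0 => i _; exact: Lp_norm_ge0].
Qed.

Lemma W1_norm_lty p w : W1 Omega p w -> (W1_norm Omega p w < +oo)%E.
Proof.
move=> [/LpP[_ w1] w2 _]; apply: lte_add_pinfty => //.
by apply/lte_sum_pinfty => i _; have /LpP[] := w2 i.
Qed.

Lemma Lp_norm_grad_le p w i : (Lp_norm Omega p%:E (w.2 i) <= W1_norm Omega p w)%E.
Proof.
rewrite /W1_norm (bigD1 i)//= addeCA leeDl// adde_ge0 ?Lp_norm_ge0//.
by apply: sume_ge0 => j _; exact: Lp_norm_ge0.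
Qed.

Lemma W1_norm0 p : 1 <= p -> W1_norm Omega p 0 = 0%E.
Proof.
move=> p1; rewrite /W1_norm Lp_norm0// add0e big1// => i _.
Qed.

Lemma W1B p v w : 1 <= p -> W1 Omega p v -> W1 Omega p w -> W1 Omega p (v - w).
Proof.
move=> p1 vp wp; rewrite -scaleN1r addrC; exact: W1_linear.
Qed.

Lemma W1_normBC p v w : 1 <= p -> W1 Omega p v -> W1 Omega p w ->
  W1_norm Omega p (v - w) = W1_norm Omega p (w - v).
Proof.
move=> p1 vp wp; rewrite -[v - w]opprB -scaleN1r W1_normZ//; last exact: W1B.
by rewrite normrN1 mul1e.
Qed.

(** A vanishing seminorm means equality a.e., which does not depend on the exponent. Thus
    identification in W^{1,2} carries estimates of exponent s from one representative to another. *)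
Lemma W1_norm_sub0_eq p s v w : 1 <= p -> 1 <= s -> W1 Omega p v -> W1 Omega p w ->
  W1_norm Omega p (v - w) = 0%E -> W1_norm Omega s v = W1_norm Omega s w.
Proof.
move=> p1 s1 [v1 v2 _] [w1 w2 _].
move=> vw; have N1 : Lp_norm Omega p%:E (v.1 - w.1) = 0%E.
  apply/eqP; rewrite eq_le Lp_norm_ge0 andbT -vw /W1_norm leeDl//.
  by apply: sume_ge0 => i _; exact: Lp_norm_ge0.
have N2 i : Lp_norm Omega p%:E (v.2 i - w.2 i) = 0%E.
  by apply/eqP; rewrite eq_le Lp_norm_ge0 andbT -vw; exact: (Lp_norm_grad_le p (v - w)).
have s0 : 0 < s by exact: lt_le_trans s1.
have aux f g : Lp Omega p%:E f -> Lp Omega p%:E g -> Lp_norm Omega p%:E (f - g)%R = 0%E ->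
    Lp_norm Omega s%:E f = Lp_norm Omega s%:E g.
  move=> fp gp fg; have /LpP[mf _] := fp; have /LpP[mg _] := gp.
  by apply: ae_eq_Lnorm => //; exact: ae_eq_of_Lp_norm_sub fg.
congr (_ + _)%E; first exact: aux.
by apply: eq_bigr => i _; exact: aux.
Qed.

End sobolev.

Section traces.
Context {R : realType} {n : nat}.
Local Notation V := 'rV[R]_n.+2.
Local Notation I := 'I_n.+2.
Local Notation leb := (@lebesgue_rV R n.+1).
Local Notation surf := (@surface_measure R n).
Variable Omega Gam : set V.
Hypothesis mOmega :
  measurable (Omega : set (caratheodory_type (@lebesgue_outer R n.+1))).
Hypothesis fOmega : (leb Omega < +oo)%E.
Implicit Types (f g h : V -> R) (p q r s a : R) (v w : @sob R n) (D : set V).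

Lemma surface_Lp_linear D p a f g : 1 <= p ->
  surface_Lp D p f -> surface_Lp D p g -> surface_Lp D p (a *: f + g).
Proof.
by move=> p1 fp gp; rewrite /surface_Lp/= restrict_linear; exact: Lfun_linear.
Qed.

Lemma le_surface_Lp_norm_linear D p a f g : 1 <= p ->
  surface_Lp D p f -> surface_Lp D p g ->
  (surface_Lp_norm D p (a *: f + g)%R <=
   `|a|%:E * surface_Lp_norm D p f + surface_Lp_norm D p g)%E.
Proof.
move=> p1 fp gp; rewrite /surface_Lp_norm restrict_linear.
rewrite -(Lfun_LnormZ a _ fp)//.
have afp : (a *: (f \_ D) : V -> R) \in Lfun surf p%:E.
  have := Lfun_linear a (p1 : (1%:E <= p%:E)%E) fp
    (Lfun_submod_closed surf (p1 : (1%:E <= p%:E)%E)).1.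
  by rewrite addr0.
move: afp gp => /Lfun_measurableP[maf _] /Lfun_measurableP[mg _].
exact: eminkowski.
Qed.

Lemma surface_Lp0 D p : 1 <= p -> surface_Lp D p (0 : V -> R).
Proof.
move=> p1; rewrite /surface_Lp/= restrict0.
exact: (Lfun_submod_closed surf (p1 : (1%:E <= p%:E)%E)).1.
Qed.

Lemma le_W1_norm_linear p a v w : 1 <= p -> W1 Omega p v -> W1 Omega p w ->
  (W1_norm Omega p (a *: v + w)%R <=
   `|a|%:E * W1_norm Omega p v + W1_norm Omega p w)%E.
Proof.
move=> p1 vp wp; have avp : W1 Omega p (a *: v).
  by rewrite -[a *: v]addr0; apply: W1_linear => //; exact: W1_0.
by apply: le_trans (le_W1_normD p1 avp wp) _; rewrite W1_normZ.
Qed.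

(** A squeeze argument for the approximating sequences in the definition of the trace. *)
Lemma cvge0_linear_le (A B C : nat -> \bar R) a :
  (forall k, 0 <= C k)%E -> (forall k, C k <= `|a|%:E * A k + B k)%E ->
  A k @[k --> \oo] --> 0%E -> B k @[k --> \oo] --> 0%E ->
  C k @[k --> \oo] --> 0%E.
Proof.
move=> C0 CAB A0 B0.
have AB0 : (`|a|%:E * A k + B k)%E @[k --> \oo] --> 0%E.
  rewrite -[X in _ --> X]adde0 -[X in _ --> (X + _)%E](mule0 `|a|%:E).
  by apply: cvgeD => //; apply: cvgeZl.
apply: (squeeze_cvge _ (cvg_cst 0%E) AB0).
by apply: nearW => k; rewrite C0 CAB.
Qed.

(** The same linear combination of the two approximating sequences of smooth functions approximates
    the combined function and its trace. *)
Lemma is_trace_linear p a v w g h : 1 <= p -> W1 Omega p v -> W1 Omega p w ->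
  is_trace Omega p v g -> is_trace Omega p w h ->
  is_trace Omega p (a *: v + w) (a *: g + h).
Proof.
move=> p1 vp wp [gp [phi [phi1 phi2 phi3 phi4 phi5]]].
move=> [hp [psi [psi1 psi2 psi3 psi4 psi5]]].
split; first exact: surface_Lp_linear.
exists (fun k => a *: phi k + psi k).
have E k : ((a *: phi k + psi k, fun i => pderiv i (a *: phi k + psi k)) : sob) =
    a *: ((phi k, fun i => pderiv i (phi k)) : sob) +
    ((psi k, fun i => pderiv i (psi k)) : sob).
  congr pair; apply/funext => i; rewrite pderiv_linear// => x.
    exact: (phi1 k [::]).2.
  exact: (psi1 k [::]).2.
split.
- by move=> k; exact: smooth_linear.
- by move=> k; exact: surface_Lp_linear.
- by move=> k; rewrite E; exact: W1_linear.
- apply: (cvge0_linear_le _ _ phi4 psi4 (a := a)) => k; first exact: W1_norm_ge0.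
  rewrite E opprD addrACA -scalerBr.
  by apply: le_W1_norm_linear => //; exact: W1B.
- apply: (cvge0_linear_le _ _ phi5 psi5 (a := a)) => k; first exact: Lnorm_ge0.
  rewrite opprD addrACA -scalerBr.
  have SB (f1 g1 : V -> R) : surface_Lp (boundary Omega) p f1 ->
      surface_Lp (boundary Omega) p g1 -> surface_Lp (boundary Omega) p (f1 - g1).
    by move=> *; rewrite -scaleN1r addrC; exact: surface_Lp_linear.
  by apply: le_surface_Lp_norm_linear => //; exact: SB.
Qed.

Lemma trace_on_linear p a v w g h : 1 <= p -> W1 Omega p v -> W1 Omega p w ->
  trace_on Omega Gam p v g -> trace_on Omega Gam p w h ->
  trace_on Omega Gam p (a *: v + w) (a *: g + h).
Proof.
move=> p1 vp wp [g' [tg eg]] [h' [th eh]]; exists (a *: g' + h').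
split; first exact: is_trace_linear.
apply: ae_impl2 eg eh => x /= eg eh Gx.
transitivity (a * g' x + h' x); first by [].
by rewrite eg// eh.
Qed.

Lemma W10_linear p a v w : 1 <= p -> W10 Omega Gam p v -> W10 Omega Gam p w ->
  W10 Omega Gam p (a *: v + w).
Proof.
move=> p1 [vp tv] [wp tw]; split; first exact: W1_linear.
have := trace_on_linear a p1 vp wp tv tw.
have -> // : a *: cst 0 + cst 0 = cst 0 :> (V -> R).
by rewrite -[cst 0]/(0 : V -> R) scaler0 addr0.
Qed.

Lemma W10B p v w : 1 <= p -> W10 Omega Gam p v -> W10 Omega Gam p w ->
  W10 Omega Gam p (v - w).
Proof. by move=> *; rewrite -scaleN1r addrC; exact: W10_linear. Qed.

Lemma W10D p v w : 1 <= p -> W10 Omega Gam p v -> W10 Omega Gam p w ->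
  W10 Omega Gam p (v + w).
Proof. by move=> *; rewrite -[v]scale1r; exact: W10_linear. Qed.

Lemma W10_0 p : 1 <= p -> W10 Omega Gam p 0.
Proof.
move=> p1; split; first exact: W1_0.
exists 0; split; last exact: nearW.
split; first exact: surface_Lp0.
exists (fun=> 0).
have E : ((0 : V -> R, fun i => pderiv i (0 : V -> R)) : @sob R n) = 0.
  congr pair; apply/funext => i; apply/funext => x; exact: derive_cst.
split.
- by move=> _; exact: smooth0.
- by move=> _; exact: surface_Lp0.
- by move=> _; rewrite E; exact: W1_0.
- by rewrite E subr0 W1_norm0//; exact: cvg_cst.
- rewrite subr0 /surface_Lp_norm restrict0.
  rewrite (@Lnorm0 _ _ _ _ p%:E); first exact: cvg_cst.
  by rewrite eqe gt_eqF// (lt_le_trans ltr01).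
Qed.

(** The smooth functions that approximate v approximate w as well, by the triangle inequality; hence
    a vanishing trace is a property of the class. *)
Lemma W10_of_norm_sub0 p v w : 1 <= p -> W10 Omega Gam p v -> W1 Omega p w ->
  W1_norm Omega p (w - v) = 0%E -> W10 Omega Gam p w.
Proof.
move=> p1 [vp [g [[gp [phi [phi1 phi2 phi3 phi4 phi5]]] ge]]] wp wv.
split=> //; exists g; split => //; split => //; exists phi; split => //.
apply: (cvge0_linear_le _ _ phi4 (cvg_cst 0%E) (a := 1)) => k.
  exact: W1_norm_ge0.
rewrite normr1 mul1e -wv (W1_normBC _ _ p1 wp vp)//.
have -> : ((phi k, fun i => pderiv i (phi k)) : sob) - w =
    ((phi k, fun i => pderiv i (phi k)) - v) + (v - w) by rewrite addrA subrK.
by apply: le_W1_normD => //; exact: W1B.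
Qed.

End traces.

(** * Functionals v |-> int G . grad v and admissible coefficients *)

Section flux_forms.
Context {R : realType} {n : nat}.
Local Notation V := 'rV[R]_n.+2.
Local Notation I := 'I_n.+2.
Local Notation leb := (@lebesgue_rV R n.+1).
Variable Omega Gam : set V.
Hypothesis mOmega :
  measurable (Omega : set (caratheodory_type (@lebesgue_outer R n.+1))).
Implicit Types (f g h : V -> R) (G H : I -> V -> R) (p q r s a : R).
Implicit Types (v w : @sob R n).

Definition flux_form G v : R := \int[leb]_(x in Omega) (\sum_i G i x * v.2 i x).

Lemma flux_formE f v w :
  \int[leb]_(x in Omega) (f x * grad_dot v w x) = flux_form (fun i => f \* v.2 i) w.
Proof.
apply: eq_Rintegral => x _; rewrite /grad_dot mulr_sumr.
by apply: eq_bigr => i _; rewrite mulrA.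
Qed.

(** The symmetry of the energy form: linearity and bounds in the test function become linearity and
    bounds in the state. *)
Lemma flux_formC f v w :
  flux_form (fun i => f \* v.2 i) w = flux_form (fun i => f \* w.2 i) v.
Proof.
apply: eq_Rintegral => x _; apply: eq_bigr => i _ /=; exact: mulrAC.
Qed.

(** Hoelder's inequality makes each summand integrable. The sum is then taken out and the integrals
    are put over the whole space, where the estimates of products apply. *)
Lemma flux_form_integrand G v p q : 0 < p -> 0 < q -> 1 = p^-1 + q^-1 ->
  (forall i, Lp Omega p%:E (G i)) -> (forall i, Lp Omega q%:E (v.2 i)) ->
  Lp Omega 1 (fun x => \sum_i G i x * v.2 i x) /\
  flux_form G v = \sum_i \int[leb]_x ((G i \_ Omega) x * (v.2 i \_ Omega) x).
Proof.
move=> p0 q0 pq Gp vq.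
have Gv i : (G i \_ Omega : caratheodory_type (@lebesgue_outer R n.+1) -> R) \*
    (v.2 i \_ Omega) \in Lfun leb 1.
  by apply: (Lfun_mul _ p0 q0 _ (Gp i) (vq i)); rewrite ?invr1.
have [S1 S2] := Lfun1_sum (index_enum I) Gv.
have E : (fun x => \sum_i G i x * v.2 i x) \_ Omega =
    (fun x => \sum_i (G i \_ Omega) x * (v.2 i \_ Omega) x).
  rewrite restrict_sum; apply/funext => x; apply: eq_bigr => i _.
  exact: (congr1 (@^~ x) (restrictM Omega (G i) (v.2 i))).
split; first by rewrite /Lp/= E.
by rewrite /flux_form Rintegral_mkcond E.
Qed.

Lemma flux_form_bound G v p q : 0 < p -> 0 < q -> 1 = p^-1 + q^-1 ->
  (forall i, Lp Omega p%:E (G i)) -> (forall i, Lp Omega q%:E (v.2 i)) ->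
  (`|flux_form G v|%:E <=
   (\sum_i Lp_norm Omega p%:E (G i)) * W1_norm Omega q v)%E.
Proof.
move=> p0 q0 pq Gp vq; rewrite (flux_form_integrand p0 q0 pq Gp vq).2.
rewrite ge0_sume_distrl; last by move=> i _; exact: Lp_norm_ge0.
apply: (@le_trans _ _ (\sum_i
    `|\int[leb]_x ((G i \_ Omega) x * (v.2 i \_ Omega) x)|)%:E).
  by rewrite lee_fin; exact: ler_norm_sum.
rewrite -sumEFin; apply: lee_sum => i _.
apply: le_trans (normr_Rintegral_hoelder p0 q0 pq (Gp i) (vq i)) _.
apply: lee_wpmul2l; first exact: Lnorm_ge0.
exact: Lp_norm_grad_le.
Qed.

Lemma flux_form_linearr G v w p q a : 0 < p -> 0 < q -> 1 = p^-1 + q^-1 ->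
  (forall i, Lp Omega p%:E (G i)) ->
  (forall i, Lp Omega q%:E (v.2 i)) -> (forall i, Lp Omega q%:E (w.2 i)) ->
  flux_form G (a *: v + w) = a * flux_form G v + flux_form G w.
Proof.
move=> p0 q0 pq Gp vq wq.
have /= <- := Rintegral_Lp1_linear mOmega a
  (flux_form_integrand p0 q0 pq Gp vq).1 (flux_form_integrand p0 q0 pq Gp wq).1.
apply: eq_Rintegral => x _; rewrite mulr_sumr -big_split/=.
by apply: eq_bigr => i _; rewrite mulrCA -mulrDr.
Qed.

Lemma flux_form_linearl G H v p q a : 0 < p -> 0 < q -> 1 = p^-1 + q^-1 ->
  (forall i, Lp Omega p%:E (G i)) -> (forall i, Lp Omega p%:E (H i)) ->
  (forall i, Lp Omega q%:E (v.2 i)) ->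
  flux_form (a *: G + H) v = a * flux_form G v + flux_form H v.
Proof.
move=> p0 q0 pq Gp Hp vq.
have /= <- := Rintegral_Lp1_linear mOmega a
  (flux_form_integrand p0 q0 pq Gp vq).1 (flux_form_integrand p0 q0 pq Hp vq).1.
apply: eq_Rintegral => x _; rewrite mulr_sumr -big_split/=.
by apply: eq_bigr => i _; rewrite mulrA -mulrDl.
Qed.

Lemma conj_expP s : 1 < s -> 0 < conj_exp s /\ 1 = s^-1 + (conj_exp s)^-1.
Proof.
move=> s1; have s0 : 0 < s by exact: lt_trans s1.
split; first by rewrite /conj_exp divr_gt0// subr_gt0.
rewrite /conj_exp invf_div -[X in X + _]mul1r -mulrDl addrC subrK.
by rewrite divff// gt_eqF.
Qed.

(** Hoelder's inequality with s and [conj_exp s]: the sum of the L^s norms is at once the continuity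
    constant and a bound of the dual norm. The sign is that of the linearized equation. *)
Lemma Wm1_flux_form G s : 1 < s -> (forall i, Lp Omega s%:E (G i)) ->
  Wm1 Omega Gam s (fun v => - flux_form G v) /\
  (dual_norm Omega Gam s (fun v => (- flux_form G v)%R) <=
   \sum_i Lp_norm Omega s%:E (G i))%E.
Proof.
move=> s1 Gs; have s0 : 0 < s by exact: lt_trans s1.
have [c0 sc] := conj_expP s1.
have N0 : (0 <= \sum_i Lp_norm Omega s%:E (G i))%E.
  by apply: sume_ge0 => i _; exact: Lp_norm_ge0.
have Nfin : (\sum_i Lp_norm Omega s%:E (G i) < +oo)%E.
  by apply/lte_sum_pinfty => i _; have /LpP[] := Gs i.
split; first split.
- move=> a v w [[_ v2 _] _] [[_ w2 _] _].
  by rewrite (flux_form_linearr a s0 c0 sc)// opprD mulrN.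
- exists (fine (\sum_i Lp_norm Omega s%:E (G i))) => v [[_ v2 _] _].
  by rewrite fineK ?ge0_fin_numE// normrN; exact: flux_form_bound.
- apply: ge_ereal_sup => _ [v [[[_ v2 _] _] v1] <-]; rewrite normrN.
  apply: le_trans (flux_form_bound s0 c0 sc Gs v2) _.
  by rewrite -[leRHS]mule1; apply: lee_wpmul2l.
Qed.

Lemma Wm1_dual_norm_lty s (F : sob -> R) : Wm1 Omega Gam s F ->
  (dual_norm Omega Gam s F < +oo)%E.
Proof.
(* The constant M may be negative, whence its absolute value. *)
move=> [_ [M HM]]; apply: (@le_lt_trans _ _ `|M|%:E); last exact: ltry.
apply: ge_ereal_sup => _ [v [vW v1] <-]; apply: le_trans (HM _ vW) _.
apply: (@le_trans _ _ (`|M|%:E * W1_norm Omega (conj_exp s) v)%E).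
  by apply: lee_wpmul2r; [exact: W1_norm_ge0|rewrite lee_fin ler_norm].
by rewrite -[leRHS]mule1; apply: lee_wpmul2l.
Qed.

End flux_forms.

(** * Convexity and uniform bounds of the admissible set *)

Section admissible_coefficients.
Context {R : realType} {n : nat}.
Local Notation V := 'rV[R]_n.+2.
Local Notation I := 'I_n.+2.
Local Notation leb := (@lebesgue_rV R n.+1).
Variable Omega : set V.
Hypothesis mOmega :
  measurable (Omega : set (caratheodory_type (@lebesgue_outer R n.+1))).
Hypothesis fOmega : (leb Omega < +oo)%E.
Implicit Types (u w phi : V -> R) (ul uu t : R).

Lemma Lp1_divergence_mul u (phi : I -> V -> R) : Lp Omega 1 u ->
  (forall i, C1 (phi i) /\ compactly_supported_in Omega (phi i)) ->
  Lp Omega 1 (u \* divergence phi).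
Proof.
move=> u1 phi1.
have -> : u \* divergence phi = (fun x => \sum_i (u \* pderiv i (phi i)) x).
  by apply/funext => x; rewrite /= mulr_sumr.
rewrite /Lp/= restrict_sum; apply: (Lfun1_sum _ _).1 => i.
have [/(_ i)[_ ci] cs] := phi1 i.
have [M HM] := compactly_supported_bounded ci (@pderiv_out_support _ _ i (phi i)) cs.
exact: (Lp1_bounded_continuous_mul mOmega fOmega (lexx 1) u1 ci HM).
Qed.

(** For each test field the integral is linear in the function, so it is at most t A + (1 - t) B for
    bounds A and B of the two variations; the supremum inherits this bound. *)
Lemma BV_convex u w t : 0 <= t <= 1 -> BVspace Omega u -> BVspace Omega w ->
  BVspace Omega (t *: u + (1 - t) *: w).
Proof.
(* Real bounds in place of the extended real variations, so that the convex combination is taken in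
   R. *)
have bnd (x : \bar R) : (x < +oo)%E -> exists2 A : R, 0 <= A & (x <= A%:E)%E.
  case: x => [x|//|] _; last by exists 0 => //; rewrite leNye.
  by exists `|x| => //; rewrite lee_fin ler_norm.
move=> /andP[t0 t1] [u1 /bnd[A A0 uA]] [w1 /bnd[B B0 wB]].
have w1' : Lp Omega 1 ((1 - t) *: w).
  by rewrite -[_ *: w]addr0; apply: Lp_linear => //; exact: Lp0.
split; first exact: Lp_linear.
apply: (@le_lt_trans _ _ (t * A + (1 - t) * B)%:E); last exact: ltry.
apply: ge_ereal_sup => _ [phi [phi1 phi2] <-].
have iu := Lp1_divergence_mul u1 phi1.
have iw := Lp1_divergence_mul w1 phi1.
have uE : (\int[leb]_(x in Omega) (u x * divergence phi x)%:E <= A%:E)%E.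
  by apply: le_trans uA; apply: ereal_sup_ubound; exists phi.
have wE : (\int[leb]_(x in Omega) (w x * divergence phi x)%:E <= B%:E)%E.
  by apply: le_trans wB; apply: ereal_sup_ubound; exists phi.
have int f : Lp Omega 1 f -> leb.-integrable Omega (EFin \o f).
  move=> /Lfun1_integrable if1.
  by apply/integrable_mkcond => //; rewrite restrict_comp.
have -> : (\int[leb]_(x in Omega) ((t *: u + (1 - t) *: w) x * divergence phi x)%:E =
    \int[leb]_(x in Omega) (t%:E * (u x * divergence phi x)%:E +
      (1 - t)%:E * (w x * divergence phi x)%:E))%E.
  apply: eq_integral => x _; rewrite -!EFinM -EFinD; congr (_%:E).
  by rewrite !mulrA -mulrDl.
rewrite integralD//; [|exact: integrableZl (int _ iu)|exact: integrableZl (int _ iw)].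
rewrite !integralZl//; [|exact: int iw|exact: int iu].
rewrite [leRHS]EFinD; apply: leeD; rewrite [leRHS]EFinM; apply: lee_wpmul2l => //.
by rewrite lee_fin subr_ge0.
Qed.

Lemma Uad_convex ul uu u w t : 0 <= t <= 1 -> Uad Omega ul uu u ->
  Uad Omega ul uu w -> Uad Omega ul uu (t *: u + (1 - t) *: w).
Proof.
move=> t01 [ub ul_u] [wb ul_w]; split; first exact: BV_convex.
apply: ae_impl2 ul_u ul_w => x /= + + Ox.
move=> /(_ Ox)/andP[u1 u2] /(_ Ox)/andP[w1 w2]; move: t01 => /andP[t0 t1].
rewrite -[_ x]/(t * u x + (1 - t) * w x); apply/andP; split.
  have -> : ul = t * ul + (1 - t) * ul by ring.
  by apply: lerD; apply: ler_wpM2l => //; rewrite subr_ge0.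
have -> : uu = t * uu + (1 - t) * uu by ring.
by apply: lerD; apply: ler_wpM2l => //; rewrite subr_ge0.
Qed.

Lemma Uad_ae_bounded ul uu u : 0 <= ul -> ul <= uu -> Uad Omega ul uu u ->
  ae_bounded Omega u uu.
Proof.
move=> ul0 uluu [[/LpP[mu _] _] ub]; split => //.
have ub' := ub; apply: ae_impl2 ub ub' => x /= + _; rewrite patchE.
case: ifPn => [/set_mem Ox /(_ Ox)/andP[ulx ux]|_ _].
  by rewrite ger0_norm//; exact: le_trans ulx.
by rewrite normr0; exact: le_trans uluu.
Qed.

(** Both u and u + phi take values in [ul, uu] with ul >= 0, so |phi| <= uu - ul <= uu. This uniform
    bound turns smallness of phi in a weaker norm into smallness of phi g in L^s. *)
Lemma Uad_diff_ae_bounded ul uu u phi : 0 <= ul -> ul <= uu -> Uad Omega ul uu u ->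
  Uad Omega ul uu (u + phi) -> ae_bounded Omega phi uu.
Proof.
move=> ul0 uluu [[u1 _] ub] [[w1 _] wb]; split.
  have : Lp Omega 1 (-1 *: u + (u + phi)) by exact: Lp_linear.
  by rewrite scaleN1r addKr => /LpP[].
apply: ae_impl2 ub wb => x /= + +; rewrite patchE.
case: ifPn => [/set_mem Ox /(_ Ox)/andP[ulx ux] /(_ Ox)|_ _ _].
  rewrite -[(u + phi) x]/(u x + phi x) => /andP[wl wu].
  by rewrite ler_norml; apply/andP; split; lra.
by rewrite normr0; lra.
Qed.

End admissible_coefficients.

(** * The state equation and its linearization *)

Section states.
Context {R : realType} {n : nat}.
Local Notation V := 'rV[R]_n.+2.
Local Notation I := 'I_n.+2.
Local Notation leb := (@lebesgue_rV R n.+1).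
Variable Omega Gamt : set V.
Hypothesis mOmega :
  measurable (Omega : set (caratheodory_type (@lebesgue_outer R n.+1))).
Hypothesis fOmega : (leb Omega < +oo)%E.
Implicit Types (u phi fD : V -> R) (F : @sob R n -> R) (p q a : R) (v w y z : @sob R n).

Lemma W1_norm_sub0_trans p x y z : 1 <= p -> W1 Omega p x -> W1 Omega p y ->
  W1 Omega p z -> W1_norm Omega p (x - y) = 0%E -> W1_norm Omega p (y - z) = 0%E ->
  W1_norm Omega p (x - z) = 0%E.
Proof.
move=> p1 xp yp zp xy yz; apply/eqP; rewrite eq_le W1_norm_ge0 andbT.
have -> : x - z = (x - y) + (y - z) by rewrite addrA subrK.
apply: le_trans (le_W1_normD p1 _ _) _; try exact: W1B.
by rewrite xy yz adde0.
Qed.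

Lemma W1_norm_sub0_sym p x y : 1 <= p -> W1 Omega p x -> W1 Omega p y ->
  W1_norm Omega p (x - y) = 0%E -> W1_norm Omega p (y - x) = 0%E.
Proof. by move=> p1 xp yp; rewrite (W1_normBC mOmega fOmega p1 xp yp). Qed.

Lemma slobodeckij0 p : 1 <= p -> slobodeckij Gamt p (cst 0 : V -> R) /\
  slobodeckij_norm Gamt p (cst 0 : V -> R) = 0%E.
Proof.
move=> p1; have p0 : p != 0 by rewrite gt_eqF// (lt_le_trans ltr01).
have N0 : slobodeckij_norm Gamt p (cst 0 : V -> R) = 0%E.
  rewrite /slobodeckij_norm.
  rewrite integral0_eq; last by move=> x _; rewrite normr0 powR0.
  rewrite add0e integral0_eq; first by rewrite poweR0r// invr_neq0.
  move=> x _; apply: integral0_eq => z _.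
  by rewrite subrr normr0 powR0// mul0r.
split=> //; split; first exact: surface_Lp0.
by rewrite N0.
Qed.

Lemma Rintegral_grad_dot0 u v : \int[leb]_(x in Omega) (u x * grad_dot 0 v x) = 0.
Proof.
apply: Rintegral0_eq => x _; rewrite /grad_dot big1 ?mulr0// => i _; exact: mul0r.
Qed.

Lemma is_lift0 p : 1 <= p -> is_lift Omega Gamt p (cst 0) 0.
Proof.
move=> p1; have [W T] := W10_0 Gamt mOmega p1; split => // v _.
apply: Rintegral0_eq => x _; rewrite /grad_dot big1// => i _; exact: mul0r.
Qed.

(** The state equation with homogeneous Dirichlet data, freed from the lift; the next lemmas
    identify it with [is_state] for the datum [cst 0]. *)
Definition solves u F z : Prop := W10 Omega Gamt 2 z /\
  forall v, W10 Omega Gamt 2 v ->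
    \int[leb]_(x in Omega) (u x * grad_dot z v x) = F v.

Let l12 : 1 <= 2 :> R. Proof. by rewrite ler1n. Qed.

(** The two states may come with different lifts w and w' of the same datum. The difference w' - w
    has trace fD - fD = 0 on [Gamt], and y' - y is the sum of (y' - w') - (y - w) and w' - w. *)
Lemma is_state_sub_W10 (f f' : @sob R n -> R) fD u u' y y' :
  is_state Omega Gamt f fD u y -> is_state Omega Gamt f' fD u' y' ->
  W10 Omega Gamt 2 (y' - y).
Proof.
move=> [_ [w [[wp tw _] yw]] _] [_ [w' [[wp' tw' _] yw']] _].
have yy : W10 Omega Gamt 2 ((y' - w') - (y - w)) by exact: W10B l12 yw' yw.
have ww : W10 Omega Gamt 2 (w' - w).
  split; first exact: W1B.
  rewrite -scaleN1r addrC.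
  have := trace_on_linear mOmega fOmega (-1) l12 wp wp' tw tw'.
  by have -> : -1 *: fD + fD = cst 0 :> (V -> R) by rewrite scaleN1r addNr.
have := W10D mOmega fOmega l12 yy ww.
by rewrite opprB addrACA subrK addrAC subrr sub0r.
Qed.

Lemma solves_is_state u F z : solves u F z -> is_state Omega Gamt F (cst 0) u z.
Proof.
move=> [zW zF]; split => //; first by case: zW.
by exists 0; split; [exact: is_lift0|rewrite subr0].
Qed.

Lemma is_state_solves u F z : is_state Omega Gamt F (cst 0) u z -> solves u F z.
Proof.
move=> zs; split; last by case: zs.
(* The zero function is a state with the same Dirichlet datum 0, so that z = z - 0 has vanishing
   trace. *)
have s0 : is_state Omega Gamt (fun=> 0) (cst 0) u 0.
  apply: solves_is_state; split; first exact: W10_0.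
  by move=> v _; exact: Rintegral_grad_dot0.
by have := is_state_sub_W10 s0 zs; rewrite subr0.
Qed.

Lemma inv2D : 1 = 2^-1 + 2^-1 :> R. Proof. by field. Qed.

Lemma Lp2_coef_grad u (M : R) w i : 0 <= M -> ae_bounded Omega u M ->
  W1 Omega 2 w -> Lp Omega 2%:E (u \* w.2 i).
Proof. by move=> M0 uM [_ w2 _]; exact: (Lp_bounded_mul l12 M0 uM (w2 i)). Qed.

Lemma energy_linear u (M : R) a y z v : 0 <= M -> ae_bounded Omega u M ->
  W1 Omega 2 y -> W1 Omega 2 z -> W1 Omega 2 v ->
  \int[leb]_(x in Omega) (u x * grad_dot (a *: y + z) v x) =
  a * \int[leb]_(x in Omega) (u x * grad_dot y v x) +
  \int[leb]_(x in Omega) (u x * grad_dot z v x).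
Proof.
move=> M0 uM y2 z2 v2; rewrite !flux_formE.
rewrite ![flux_form _ _ v]flux_formC.
have uv i := Lp2_coef_grad i M0 uM v2.
by rewrite (flux_form_linearr mOmega a _ _ inv2D uv)//; [case: y2|case: z2].
Qed.

Lemma solves_linear u (M : R) a F F' z z' : 0 <= M -> ae_bounded Omega u M ->
  solves u F z -> solves u F' z' ->
  solves u (fun v => a * F v + F' v) (a *: z + z').
Proof.
move=> M0 uM [zW zF] [zW' zF']; split; first exact: W10_linear.
move=> v vW; rewrite (energy_linear _ M0 uM)//; [|by case: zW|by case: zW'|by case: vW].
by rewrite zF// zF'.
Qed.

Lemma solves_ext u F F' z : (forall v, W10 Omega Gamt 2 v -> F v = F' v) ->
  solves u F z -> solves u F' z.
Proof. by move=> FF' [zW zF]; split => // v vW; rewrite zF// FF'. Qed.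

(** The difference of the two sides is the energy form at y - z, which Hoelder's inequality bounds
    by a multiple of the seminorm of y - z. The weak equation thus passes to every
    representative. *)
Lemma energy_norm_sub0 u (M : R) y z v : 0 <= M -> ae_bounded Omega u M ->
  W1 Omega 2 y -> W1 Omega 2 z -> W1 Omega 2 v -> W1_norm Omega 2 (y - z) = 0%E ->
  \int[leb]_(x in Omega) (u x * grad_dot y v x) =
  \int[leb]_(x in Omega) (u x * grad_dot z v x).
Proof.
move=> M0 uM y2 z2 v2 yz; apply/eqP; rewrite -subr_eq0 addrC -mulN1r.
rewrite -(energy_linear _ M0 uM)// scaleN1r addrC flux_formE flux_formC.
have uv i := Lp2_coef_grad i M0 uM v2.
have yz2 : W1 Omega 2 (y - z) by exact: W1B.
have yz2' i : Lp Omega 2%:E ((y - z).2 i) by case: yz2.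
have := flux_form_bound (ltr0n R 2) (ltr0n R 2) inv2D uv yz2'.
by rewrite yz mule0 lee_fin normr_le0.
Qed.

Section groger.
Variables (U : set (V -> R)) (s : R).
Hypothesis well_posed : state_well_posed Omega Gamt U s.
Hypothesis exponent : groger_exponent Omega Gamt U s.

Lemma is_state_ctrl (sigma : R) (f : @sob R n -> R) fD u : 2 <= sigma <= s ->
  Wm1 Omega Gamt sigma f -> slobodeckij Gamt sigma fD -> U u ->
  is_state Omega Gamt f fD u (ctrl_to_state Omega Gamt f fD u).
Proof.
move=> ss fs fDs Uu; have [y [yS _]] := well_posed ss fs fDs Uu.
by apply: (xgetPex 0); exists y.
Qed.

Lemma solves_ctrl (sigma : R) F u : 2 <= sigma <= s -> Wm1 Omega Gamt sigma F ->
  U u -> solves u F (ctrl_to_state Omega Gamt F (cst 0) u).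
Proof.
move=> ss Fs Uu; apply: is_state_solves; apply: (is_state_ctrl ss) => //.
by have [] := @slobodeckij0 sigma _ => //; move: ss; lra.
Qed.

Lemma solves_unique (sigma : R) F u z z' : 2 <= sigma <= s ->
  Wm1 Omega Gamt sigma F -> U u -> solves u F z -> solves u F z' ->
  W1_norm Omega 2 (z - z') = 0%E.
Proof.
move=> ss Fs Uu /solves_is_state zS /solves_is_state zS'.
have s1 : 1 <= sigma by move: ss; lra.
have [y [yS yu]] := well_posed ss Fs (slobodeckij0 s1).1 Uu.
have [z2 _ _] := zS; have [z2' _ _] := zS'; have [y2 _ _] := yS.
apply: (W1_norm_sub0_trans l12 z2 y2 z2'); first exact: yu.
by apply: W1_norm_sub0_sym => //; exact: yu.
Qed.

(** The regularity estimate with Dirichlet datum 0 concerns the representative chosen by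
    [ctrl_to_state]. Any other solution agrees with it a.e. by uniqueness in W^{1,2}, hence has the
    same norm of exponent sigma. *)
Lemma solves_estimate (sigma : R) : 2 <= sigma <= s -> exists2 C : R, 0 <= C &
  forall F u z, Wm1 Omega Gamt sigma F -> U u -> solves u F z ->
  (W1_norm Omega sigma z <= C%:E * dual_norm Omega Gamt sigma F)%E.
Proof.
move=> ss; have s1 : 1 <= sigma by move: ss; lra.
have [C [C0 HC]] := exponent ss; exists C => // F u z Fs Uu zF.
have cF := solves_ctrl ss Fs Uu.
have [[z2 _] _] := zF; have [[c2 _] _] := cF.
rewrite (W1_norm_sub0_eq l12 s1 z2 c2 (solves_unique ss Fs Uu zF cF)).
have := HC _ _ _ Fs (slobodeckij0 s1).1 Uu.
by rewrite (slobodeckij0 s1).2 add0e.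
Qed.

End groger.
End states.

(** * Differentiability of the control-to-state operator *)

Section differentiability.
Context {R : realType} {n : nat}.
Local Notation V := 'rV[R]_n.+2.
Local Notation I := 'I_n.+2.
Local Notation leb := (@lebesgue_rV R n.+1).
Variables (Omega Gamt : set V) (ul uu s : R) (q : \bar R).
Hypothesis mOmega :
  measurable (Omega : set (caratheodory_type (@lebesgue_outer R n.+1))).
Hypothesis fOmega : (leb Omega < +oo)%E.
Hypothesis ulu : 0 < ul <= uu.
Hypothesis s2 : 2 < s.
Hypothesis sq : ((2 * s / (s - 2))%:E <= q)%E.
Local Notation U := (Uad Omega ul uu).
Hypothesis well_posed : state_well_posed Omega Gamt U s.
Hypothesis exponent : groger_exponent Omega Gamt U s.
Implicit Types (u phi : V -> R) (z v : @sob R n).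

Let r : R := 2 * s / (s - 2).

Let l12 : 1 <= 2 :> R. Proof. by rewrite ler1n. Qed.
Let s0 : 0 < s. Proof. exact: lt_trans s2. Qed.
Let s1 : 1 <= s. Proof. exact: ltW (lt_trans (ltr1n R 2) s2). Qed.
Let s22 : 2 <= s <= s. Proof. by rewrite lexx andbT ltW. Qed.
Let s2s : (2 : R) <= 2 <= s. Proof. by rewrite lexx ltW. Qed.
Let r0 : 0 < r. Proof. by rewrite divr_gt0 ?mulr_gt0// subr_gt0. Qed.
Let rs2 : 2^-1 = r^-1 + s^-1.
Proof.
rewrite /r invf_div; field; rewrite !gt_eqF//=.
Qed.
Let r1 : 1 <= r.
Proof. by rewrite ler_pdivlMr ?subr_gt0// mul1r; move: s2; lra. Qed.
Let q1 : (1 <= q)%E.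
Proof. by apply: le_trans sq; rewrite lee_fin. Qed.
Let ul0 : 0 <= ul. Proof. by case/andP: ulu => /ltW. Qed.
Let uluu : ul <= uu. Proof. by case/andP: ulu. Qed.
Let uu0 : 0 <= uu. Proof. exact: le_trans uluu. Qed.

Lemma Lp2_mul_grad phi (g : I -> V -> R) i : Lp Omega q phi ->
  (forall i, Lp Omega s%:E (g i)) -> Lp Omega 2%:E (phi \* g i).
Proof.
move=> phiq gs; have [K K0 HK] := Lp_norm_le_finite mOmega r1 sq fOmega.
exact: (Lp_mul (ltr0n R 2) r0 s0 rs2 (HK _ phiq).1 (gs i)).
Qed.

(** Hoelder's inequality with 1/2 = 1/r + 1/s; K is the constant of the embedding of L^q into L^r on
    a set of finite measure. *)
Lemma sum_Lp2_norm_mul_le : exists2 K : R, 0 <= K &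
  forall phi (g : I -> V -> R), Lp Omega q phi -> (forall i, Lp Omega s%:E (g i)) ->
  (\sum_i Lp_norm Omega 2%:E (phi \* g i)%R <=
   K%:E * Lp_norm Omega q phi * \sum_i Lp_norm Omega s%:E (g i))%E.
Proof.
have [K K0 HK] := Lp_norm_le_finite mOmega r1 sq fOmega.
exists K => // phi g phiq gs; have [phir phirq] := HK _ phiq.
rewrite ge0_sume_distrr; last by move=> i _; exact: Lp_norm_ge0.
apply: lee_sum => i _.
apply: le_trans (le_Lp_norm_mul (ltr0n R 2) r0 s0 rs2 phir (gs i)) _.
by apply: lee_wpmul2r => //; exact: Lp_norm_ge0.
Qed.

Definition linearized_rhs phi z v : R := - flux_form Omega (fun i => phi \* z.2 i) v.

(** The variation comes last, so that [linearized_state u z] with z = S(u) is the candidate for the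
    derivative. *)
Definition linearized_state u z phi : @sob R n :=
  ctrl_to_state Omega Gamt (linearized_rhs phi z) (cst 0) u.

Definition higher_integrable z := W1 Omega 2 z /\ forall i, Lp Omega s%:E (z.2 i).

(** Stated for a general z because it serves twice: with z = S(u) it bounds the derivative, with z =
    S(u + phi) - S(u) it bounds the remainder. *)
Lemma linearized_rhs_estimate : exists2 C : R, 0 <= C &
  forall u phi z w, U u -> Lp Omega q phi -> higher_integrable z ->
  solves Omega Gamt u (linearized_rhs phi z) w ->
  (W1_norm Omega 2 w <=
   C%:E * Lp_norm Omega q phi * \sum_i Lp_norm Omega s%:E (z.2 i))%E.
Proof.
have [C C0 HC] := solves_estimate mOmega fOmega well_posed exponent s2s.
have [K K0 HK] := sum_Lp2_norm_mul_le.
exists (C * K); first exact: mulr_ge0.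
move=> u phi z w Uu phiq [_ zs] wF.
have [F2 FN] := Wm1_flux_form Gamt mOmega (ltr1n R 2) (fun i => Lp2_mul_grad i phiq zs).
apply: le_trans (HC _ _ _ F2 Uu wF) _.
rewrite EFinM -!muleA; apply: lee_wpmul2l => //; rewrite ?lee_fin// muleA.
exact: le_trans FN (HK _ _ phiq zs).
Qed.

Lemma solves_linearized_state u phi z : U u -> Lp Omega q phi ->
  higher_integrable z ->
  solves Omega Gamt u (linearized_rhs phi z) (linearized_state u z phi).
Proof.
move=> Uu phiq [_ zs]; apply: (solves_ctrl mOmega fOmega well_posed s2s) => //.
exact: (Wm1_flux_form Gamt mOmega (ltr1n R 2) (fun i => Lp2_mul_grad i phiq zs)).1.
Qed.

Lemma solves_linearized_unique u phi z w w' : U u -> Lp Omega q phi ->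
  higher_integrable z ->
  solves Omega Gamt u (linearized_rhs phi z) w ->
  solves Omega Gamt u (linearized_rhs phi z) w' ->
  W1_norm Omega 2 (w - w') = 0%E.
Proof.
move=> Uu phiq [_ zs]; apply: (solves_unique mOmega fOmega well_posed s2s) => //.
exact: (Wm1_flux_form Gamt mOmega (ltr1n R 2) (fun i => Lp2_mul_grad i phiq zs)).1.
Qed.

Lemma solves_linearizedP u phi z w :
  solves Omega Gamt u (linearized_rhs phi z) w <->
  is_linearized_state Omega Gamt u z phi w.
Proof. by split=> -[wW wF]; split=> // v vW; rewrite wF// flux_formE. Qed.

Lemma linearized_rhs_linear a phi psi z v : Lp Omega q phi -> Lp Omega q psi ->
  higher_integrable z -> W1 Omega 2 v ->
  linearized_rhs (a *: phi + psi) z v =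
  a * linearized_rhs phi z v + linearized_rhs psi z v.
Proof.
move=> phiq psiq [_ zs] [_ v2 _]; rewrite /linearized_rhs mulrN -opprD.
rewrite -(flux_form_linearl mOmega a (ltr0n R 2) (ltr0n R 2) inv2D
  (fun i => Lp2_mul_grad i phiq zs) (fun i => Lp2_mul_grad i psiq zs) v2).
congr (- flux_form _ _ _); apply/funext => i; apply/funext => x /=.
by rewrite -[(a *: phi + psi) x]/(a * phi x + psi x) mulrDl -mulrA.
Qed.

(** The linear combination of two linearized states solves the equation for the combined variation,
    so uniqueness gives linearity up to the seminorm. *)
Lemma linearized_state_bounded_linear u z : U u -> higher_integrable z ->
  bounded_linear (Lp Omega q) (Lp_norm Omega q) (W1 Omega 2) (W1_norm Omega 2)
    (linearized_state u z).
Proof.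
move=> Uu zs; have uM := Uad_ae_bounded ul0 uluu Uu.
have D phi (phiq : Lp Omega q phi) := solves_linearized_state Uu phiq zs.
split.
- by move=> phi /D[[]].
- move=> a phi psi phiq psiq.
  have apq := Lp_linear a q1 phiq psiq.
  apply: (solves_linearized_unique Uu apq zs (D _ apq)).
  apply: solves_ext (solves_linear mOmega fOmega a uu0 uM (D _ phiq) (D _ psiq)).
  by move=> v [vW _]; rewrite linearized_rhs_linear.
- have [C C0 HC] := linearized_rhs_estimate.
  exists (C * fine (\sum_i Lp_norm Omega s%:E (z.2 i))%E) => phi phiq.
  apply: le_trans (HC _ _ _ _ Uu phiq zs (D _ phiq)) _.
  rewrite EFinM fineK; first by rewrite -!muleA [X in (_ * X)%E]muleC.
  rewrite ge0_fin_numE; last by apply: sume_ge0 => i _; exact: Lp_norm_ge0.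
  by apply/lte_sum_pinfty => i _; have /LpP[] := zs.2 i.
Qed.

(** * First-order expansion at a fixed control *)

Section expansion.
Variables (f : @sob R n -> R) (fD u : V -> R).
Hypothesis fs : Wm1 Omega Gamt s f.
Hypothesis fDs : slobodeckij Gamt s fD.
Hypothesis Uu : U u.
Let S := ctrl_to_state Omega Gamt f fD.

Let S_state w : U w -> is_state Omega Gamt f fD w (S w).
Proof. exact: (is_state_ctrl well_posed s22). Qed.

(** Measurability of the gradient comes from W^{1,2}, finiteness of its L^s norm from the regularity
    estimate at the exponent s itself. *)
Lemma state_higher_integrable w : U w -> higher_integrable (S w).
Proof.
move=> Uw; have [S2 _ _] := S_state Uw; split => // i.
have [_ /(_ i)/LpP[mS _] _] := S2; apply/LpP; split => //.
apply: le_lt_trans (Lp_norm_grad_le Omega s (S w) i) _.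
have [C [C0 HC]] := exponent s22.
apply: le_lt_trans (HC _ _ _ fs fDs Uw) _.
apply: lte_mul_pinfty; rewrite ?lee_fin//.
apply: lte_add_pinfty; first by case: fDs.
exact: Wm1_dual_norm_lty fs.
Qed.

Lemma higher_integrableB y z : higher_integrable y -> higher_integrable z ->
  higher_integrable (y - z).
Proof.
move=> [y2 ys] [z2 zs]; split; first exact: W1B.
move=> i; have -> : (y - z).2 i = -1 *: z.2 i + y.2 i by rewrite scaleN1r addrC.
exact: Lp_linear.
Qed.

(** Tested with v, (u + phi) grad S(u + phi) and u grad S(u) both give f v. Subtracting (u + phi)
    grad S(u) from the former therefore leaves - phi grad S(u). *)
Lemma state_sub_solves phi : U (u + phi) ->
  solves Omega Gamt (u + phi) (linearized_rhs phi (S u)) (S (u + phi) - S u).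
Proof.
move=> Uw; have St := S_state Uu; have Sw := S_state Uw.
have uM := Uad_ae_bounded ul0 uluu Uu.
have wM := Uad_ae_bounded ul0 uluu Uw.
have phiM := Uad_diff_ae_bounded ul0 uluu Uu Uw.
split; first exact: is_state_sub_W10 St Sw.
move=> v vW; have [v2 _] := vW.
have [S2 _ SF] := St; have [Sw2 _ SwF] := Sw.
rewrite -scaleN1r [_ + -1 *: _]addrC.
rewrite (energy_linear mOmega (-1) uu0 wM S2 Sw2 v2) SwF// -(SF v vW).
rewrite mulN1r addrC !flux_formE /linearized_rhs.
have H i := Lp2_coef_grad i uu0 phiM S2.
have H' i := Lp2_coef_grad i uu0 uM S2.
have v2' i : Lp Omega 2%:E (v.2 i) by case: v2.
have -> : (fun i => (u + phi)%R \* (S u).2 i) =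
    1 *: (fun i => u \* (S u).2 i) + (fun i => phi \* (S u).2 i).
  by apply/funext => i; apply/funext => x; rewrite scale1r; exact: mulrDl.
rewrite (flux_form_linearl mOmega 1 (ltr0n R 2) (ltr0n R 2) inv2D H' H v2').
by rewrite mul1r opprD addrA subrr sub0r.
Qed.

(** With d = S(u + phi) - S(u), the coefficient u = (u + phi) - phi yields the right-hand side - phi
    grad S(u) - phi grad d; the linearized state removes the first term. *)
Lemma remainder_solves phi : Lp Omega q phi -> U (u + phi) ->
  solves Omega Gamt u (linearized_rhs phi (S (u + phi) - S u))
    (S (u + phi) - S u - linearized_state u (S u) phi).
Proof.
move=> phiq Uw; have hS := state_higher_integrable Uu.
have hd := higher_integrableB (state_higher_integrable Uw) hS.
set d := S (u + phi) - S u in hd *.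
have [dW dF] := state_sub_solves Uw; have [DW DF] := solves_linearized_state Uu phiq hS.
have uM := Uad_ae_bounded ul0 uluu Uu.
have phiM := Uad_diff_ae_bounded ul0 uluu Uu Uw.
split; first exact: W10B.
move=> v vW; have [v2 _] := vW; have [d2 _] := dW; have [D2 _] := DW.
rewrite -scaleN1r addrC (energy_linear mOmega (-1) uu0 uM D2 d2 v2) DF// mulN1r.
rewrite -(dF v vW) !flux_formE /linearized_rhs.
have H i := Lp2_coef_grad i uu0 phiM d2.
have H' i := Lp2_coef_grad i uu0 uM d2.
have v2' i : Lp Omega 2%:E (v.2 i) by case: v2.
have -> : (fun i => (u + phi)%R \* d.2 i) =
    1 *: (fun i => u \* d.2 i) + (fun i => phi \* d.2 i).
  by apply/funext => i; apply/funext => x; rewrite scale1r; exact: mulrDl.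
rewrite (flux_form_linearl mOmega 1 (ltr0n R 2) (ltr0n R 2) inv2D H' H v2').
by rewrite mul1r opprD addrAC addNr sub0r.
Qed.

Lemma sum_Lp_norm_mul_small (g : I -> V -> R) (eps : R) :
  (forall i, Lp Omega s%:E (g i)) -> 0 < eps ->
  exists2 delta : R, 0 < delta & forall phi, ae_bounded Omega phi uu ->
    Lp Omega q phi -> (Lp_norm Omega q phi < delta%:E)%E ->
    (\sum_i Lp_norm Omega s%:E (phi \* g i)%R <= eps%:E)%E.
Proof.
move=> gs eps0; have [K K0 HK] := Lp_norm_le_finite mOmega r1 sq fOmega.
have e0 : 0 < eps / n.+2%:R by rewrite divr_gt0.
have /choice[delta Hdelta] : forall i, exists delta : R, 0 < delta /\
    forall phi, ae_bounded Omega phi uu -> (Lp_norm Omega r%:E phi < delta%:E)%E ->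
    (Lp_norm Omega s%:E (phi \* g i)%R <= (eps / n.+2%:R)%:E)%E.
  by move=> i; have [d d0 H] := Lp_norm_mul_small s0 r0 uu0 (gs i) e0; exists d.
(* One threshold for all components of g, each of which is allowed the share eps / (n + 2). *)
pose m := \big[Num.min/1]_i delta i.
have m0 : 0 < m by apply: lt_bigmin => // i _; have [] := Hdelta i.
(* The L^r norm is at most K times the L^q norm; K + 1 is positive even if K = 0. *)
exists (m / (K + 1)); first by rewrite divr_gt0// ltr_wpDl.
move=> phi phib phiq Nphi.
have Nr : (Lp_norm Omega r%:E phi < m%:E)%E.
  apply: le_lt_trans (HK _ phiq).2 _.
  apply: (@le_lt_trans _ _ ((K + 1)%:E * Lp_norm Omega q phi)%E).
    by apply: lee_wpmul2r; [exact: Lp_norm_ge0|rewrite lee_fin lerDl].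
  by rewrite muleC -lte_pdivlMr ?ltr_wpDl// -EFinM.
apply: (@le_trans _ _ (\sum_(i < n.+2) (eps / n.+2%:R)%:E)%E).
  apply: lee_sum => i _; apply: (Hdelta i).2 => //.
  by apply: lt_le_trans Nr _; rewrite lee_fin; exact: bigmin_le.
by rewrite sumEFin lee_fin sumr_const card_ord -[leLHS]mulr_natr divfK.
Qed.

(** The variation is bounded by uu, so phi grad S(u) lies in L^s and the estimate of exponent s
    applies to the equation with coefficient u + phi. *)
Lemma state_sub_estimate : exists2 C : R, 0 <= C & forall phi, U (u + phi) ->
  (W1_norm Omega s (S (u + phi) - S u)%R <=
   C%:E * \sum_i Lp_norm Omega s%:E (phi \* (S u).2 i)%R)%E.
Proof.
have [C C0 HC] := solves_estimate mOmega fOmega well_posed exponent s22.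
exists C => // phi Uw.
have phiM := Uad_diff_ae_bounded ul0 uluu Uu Uw.
have ys i := Lp_bounded_mul s1 uu0 phiM ((state_higher_integrable Uu).2 i).
have [Fs FN] := Wm1_flux_form Gamt mOmega (lt_trans (ltr1n R 2) s2) ys.
apply: le_trans (HC _ _ _ Fs Uw (state_sub_solves Uw)) _.
by apply: lee_wpmul2l => //; rewrite ?lee_fin.
Qed.

Lemma linearized_state_feasible_derivative :
  is_feasible_derivative (Lp Omega q) (Lp_norm Omega q) (W1 Omega 2)
    (W1_norm Omega 2) U S u (linearized_state u (S u)).
Proof.
have hS := state_higher_integrable Uu.
split; first exact: linearized_state_bounded_linear.
move=> eps eps0; have [C C0 HC] := linearized_rhs_estimate.
have [D D0 HD] := state_sub_estimate.
(* The remainder is bounded by C ||phi||_q times D times the quantity made small, so this choice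
   leaves C D eps / (C D + 1) <= eps. *)
have e0 : 0 < eps / (C * D + 1) by rewrite divr_gt0// ltr_wpDl// mulr_ge0.
have [delta delta0 Hdelta] := sum_Lp_norm_mul_small hS.2 e0.
exists delta => // phi phiq Uw /andP[_ Nphi].
have phiM := Uad_diff_ae_bounded ul0 uluu Uu Uw.
have hd := higher_integrableB (state_higher_integrable Uw) hS.
apply: le_trans (HC _ _ _ _ Uu phiq hd (remainder_solves phiq Uw)) _.
have Nd : (\sum_i Lp_norm Omega s%:E ((S (u + phi)%R - S u)%R.2 i) <=
    (D * (eps / (C * D + 1)))%:E)%E.
  apply: (@le_trans _ _ (W1_norm Omega s (S (u + phi) - S u)%R)).
    by rewrite leeDr// Lp_norm_ge0.
  apply: le_trans (HD _ Uw) _; rewrite EFinM.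
  by apply: lee_wpmul2l; [rewrite lee_fin|exact: Hdelta].
apply: le_trans (lee_wpmul2l _ Nd) _.
  by apply: mule_ge0; [rewrite lee_fin|exact: Lp_norm_ge0].
rewrite muleAC; apply: lee_wpmul2r; first exact: Lp_norm_ge0.
rewrite -EFinM lee_fin mulrA mulrA ler_pdivrMr; last by rewrite ltr_wpDl// mulr_ge0.
by rewrite mulrA [leRHS]mulrC ler_pM2r// lerDl.
Qed.

End expansion.

Lemma bounded_linearZ (T : (V -> R) -> @sob R n) a phi :
  bounded_linear (Lp Omega q) (Lp_norm Omega q) (W1 Omega 2) (W1_norm Omega 2) T ->
  Lp Omega q phi -> W1_norm Omega 2 (T (a *: phi) - a *: T phi) = 0%E.
Proof.
move=> [TW Tlin [M TM]] phiq; have q00 := Lp0 Omega q1.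
have T0 : W1_norm Omega 2 (T 0) = 0%E.
  apply/eqP; rewrite eq_le W1_norm_ge0 andbT.
  by apply: le_trans (TM _ q00) _; rewrite Lp_norm0// mule0.
have W0 := TW _ q00; have Wphi := TW _ phiq.
have Wa : W1 Omega 2 (a *: T phi).
  by rewrite -[a *: _]addr0; apply: W1_linear => //; exact: W1_0.
have Wa0 : W1 Omega 2 (a *: T phi + T 0) by exact: W1_linear.
have Wap : W1 Omega 2 (T (a *: phi)).
  by apply: TW; rewrite -[a *: _]addr0; exact: Lp_linear.
apply: (W1_norm_sub0_trans mOmega fOmega l12 Wap Wa0 Wa).
  by have := Tlin a phi 0 phiq q00; rewrite addr0.
by rewrite addrC addKr.
Qed.

(** By convexity u + t phi is admissible for small t > 0. Both derivatives approximate S(u + t phi)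
    - S(u) up to t eps / 2, so by homogeneity T phi and T' phi differ by at most eps. *)
Lemma feasible_derivative_unique (S : (V -> R) -> @sob R n) T T' u phi :
  is_feasible_derivative (Lp Omega q) (Lp_norm Omega q) (W1 Omega 2)
    (W1_norm Omega 2) U S u T ->
  is_feasible_derivative (Lp Omega q) (Lp_norm Omega q) (W1 Omega 2)
    (W1_norm Omega 2) U S u T' ->
  (forall w, U w -> W1 Omega 2 (S w)) -> U u -> Lp Omega q phi -> U (u + phi) ->
  W1_norm Omega 2 (T phi - T' phi) = 0%E.
Proof.
move=> [Tlin Tder] [Tlin' Tder'] SW Uu phiq Uw.
have [TW _ [M TM]] := Tlin; have [TW' _ [M' TM']] := Tlin'.
have d2 : W1 Omega 2 (T phi - T' phi) by apply: W1B => //; [exact: TW|exact: TW'].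
(* The remainder estimate concerns variations of positive norm only; if phi has norm 0, boundedness
   makes both values vanish. *)
have [N0|N0] := eqVneq (Lp_norm Omega q phi) 0%E.
  apply/eqP; rewrite eq_le W1_norm_ge0 andbT -scaleN1r addrC.
  apply: le_trans (le_W1_norm_linear mOmega fOmega (-1) l12 (TW' _ phiq) (TW _ phiq)) _.
  rewrite normrN1 mul1e; apply: le_trans (leeD (TM' _ phiq) (TM _ phiq)) _.
  by rewrite N0 !mule0 adde0.
set N := fine (Lp_norm Omega q phi).
have NE : Lp_norm Omega q phi = N%:E.
  by rewrite fineK// ge0_fin_numE ?Lp_norm_ge0//; have /LpP[] := phiq.
have Npos : 0 < N by rewrite -lte_fin -NE lt0e N0 Lp_norm_ge0.
set d := fine (W1_norm Omega 2 (T phi - T' phi)).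
have dE : W1_norm Omega 2 (T phi - T' phi) = d%:E.
  by rewrite fineK// ge0_fin_numE ?W1_norm_ge0//; exact: W1_norm_lty.
have d0 : 0 <= d by rewrite fine_ge0// W1_norm_ge0.
rewrite dE; congr (_%:E); apply/eqP; rewrite eq_le d0 andbT.
apply/ler_addgt0Pl => eps eps0; rewrite addr0.
have e0 : 0 < eps / (2 * N) by rewrite divr_gt0// mulr_gt0.
have [delta delta0 H] := Tder _ e0; have [delta' delta0' H'] := Tder' _ e0.
(* The bound 1 keeps u + t phi between u and u + phi; the factor 2 makes t N strictly smaller than
   both thresholds. *)
pose t := Num.min 1 (Num.min delta delta' / (2 * N)).
have t0 : 0 < t by rewrite lt_min ltr01 divr_gt0 ?mulr_gt0// lt_min delta0.
have t1 : t <= 1 by rewrite ge_min lexx.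
have tN : t * N < Num.min delta delta'.
  apply: (@le_lt_trans _ _ (Num.min delta delta' / (2 * N) * N)).
    by rewrite ler_pM2r// ge_min lexx orbT.
  have m0 : 0 < Num.min delta delta' by rewrite lt_min delta0.
  have -> : Num.min delta delta' / (2 * N) * N = Num.min delta delta' / 2.
    by field; rewrite gt_eqF.
  by rewrite ltr_pdivrMr// ltr_pMr// ltr1n.
have tphiq : Lp Omega q (t *: phi).
  by rewrite -[t *: _]addr0; apply: Lp_linear => //; exact: Lp0.
have NtE : Lp_norm Omega q (t *: phi) = (t * N)%:E.
  by rewrite Lp_normZ// NE -EFinM gtr0_norm.
have Ut : U (u + t *: phi).
  have -> : u + t *: phi = t *: (u + phi) + (1 - t) *: u.
    by rewrite scalerDr scalerBl scale1r [RHS]addrC subrKA.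
  by apply: Uad_convex => //; rewrite t1 ltW.
have Nt : (0 < Lp_norm Omega q (t *: phi)%R)%E by rewrite NtE lte_fin mulr_gt0.
move: tN; rewrite lt_min => /andP[tN tN'].
have {}H := H _ tphiq Ut; rewrite Nt NtE lte_fin in H; have {}H := H tN.
have {}H' := H' _ tphiq Ut; rewrite Nt NtE lte_fin in H'; have {}H' := H' tN'.
have Z := bounded_linearZ t Tlin phiq; have Z' := bounded_linearZ t Tlin' phiq.
set x := S (u + t *: phi) - S u in H H'.
have xW : W1 Omega 2 x by apply: W1B => //; exact: SW.
have TtW := TW _ tphiq; have TtW' := TW' _ tphiq.
have scaleW a z : W1 Omega 2 z -> W1 Omega 2 (a *: z).
  by move=> zW; rewrite -[a *: z]addr0; apply: W1_linear => //; exact: W1_0.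
have B := W1B mOmega fOmega l12.
have tri a b c : W1 Omega 2 a -> W1 Omega 2 b -> W1 Omega 2 c ->
    (W1_norm Omega 2 (a - c)%R <= W1_norm Omega 2 (a - b)%R + W1_norm Omega 2 (b - c)%R)%E.
  move=> aW bW cW; have -> : a - c = (a - b) + (b - c) by rewrite addrA subrK.
  by apply: le_W1_normD => //; exact: B.
have D1 : (W1_norm Omega 2 (x - t *: T phi)%R <= (eps / (2 * N))%:E * (t * N)%:E)%E.
  apply: le_trans (tri _ _ _ xW TtW (scaleW t _ (TW _ phiq))) _.
  by rewrite Z adde0.
have D2 : (W1_norm Omega 2 (x - t *: T' phi)%R <= (eps / (2 * N))%:E * (t * N)%:E)%E.
  apply: le_trans (tri _ _ _ xW TtW' (scaleW t _ (TW' _ phiq))) _.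
  by rewrite Z' adde0.
(* The triangle inequality through x, with both errors at most (eps / (2 N)) t N; division by t then
   gives d <= eps. *)
have : (t%:E * d%:E <= (t * eps)%:E)%E.
  rewrite -dE -[t in (t%:E * _)%E](gtr0_norm t0) -W1_normZ// scalerBr.
  apply: le_trans (tri _ _ _ (scaleW t _ (TW _ phiq)) xW (scaleW t _ (TW' _ phiq))) _.
  rewrite (W1_normBC mOmega fOmega l12 (scaleW t _ (TW _ phiq)) xW).
  apply: le_trans (leeD D1 D2) _.
  rewrite -EFinM -EFinD lee_fin le_eqVlt; apply/orP; left; apply/eqP.
  by field; rewrite gt_eqF.
by rewrite -EFinM lee_fin ler_pM2l.
Qed.

End differentiability.

(* The space dimension is d = n + 2. *)
Theorem lemma2p12 (R : realType) (n : nat) (alpha : R)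
    (Omega Gamt Gam : set 'rV[R]_n.+2) (ul uu s : R)
    (f : @sob R n -> R) (fD : 'rV[R]_n.+2 -> R)
    (u : 'rV[R]_n.+2 -> R) (q : \bar R)
    (Halpha : 0 < alpha <= 1)
    (HOmega : bounded_domain Omega)
    (Hboundary : C1alpha_boundary alpha Omega)
    (HGamt : [/\ Gamt !=set0, closed Gamt, Gamt `<=` boundary Omega &
                 (0 < surface_measure Gamt)%E])
    (HGam : [/\ Gam !=set0, closed Gam, Gam `<=` boundary Omega &
                (0 < surface_measure Gam)%E])
    (Hregular : groger_regular (Omega `|` Gam))
    (Hbounds : 0 < ul <= uu)
    (Hlift : dirichlet_lift_setting Omega Gamt)
    (Hs2 : 2 < s)
    (Hstate : state_well_posed Omega Gamt (Uad Omega ul uu) s)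
    (Hs : groger_exponent Omega Gamt (Uad Omega ul uu) s)
    (Hf : Wm1 Omega Gamt s f)
    (HfD : slobodeckij Gamt s fD)
    (Hu : Uad Omega ul uu u)
    (Hq : ((2 * s / (s - 2))%:E <= q)%E) :
  let S := ctrl_to_state Omega Gamt f fD in
  let is_derivative :=
    is_feasible_derivative (Lp Omega q) (Lp_norm Omega q)
      (W1 Omega 2) (W1_norm Omega 2) (Uad Omega ul uu) S u in
  (exists S', is_derivative S') /\
  forall S', is_derivative S' ->
  forall phi, Lp Omega q phi -> Uad Omega ul uu (u + phi) ->
    is_linearized_state Omega Gamt u (S u) phi (S' phi) /\
    forall z, is_linearized_state Omega Gamt u (S u) phi z ->
      W1_norm Omega 2 (z - S' phi) = 0%E.
Proof.
have [_ oOmega _ bOmega] := HOmega.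
have mO := open_measurable_rV oOmega.
have fO := bounded_lebesgue_finite bOmega.
move=> S is_derivative; pose T := linearized_state Omega Gamt u (S u).
have derT : is_derivative T.
  exact: (linearized_state_feasible_derivative mO fO Hbounds Hs2 Hq Hstate Hs Hf HfD Hu).
split; first by exists T.
move=> S' derS' phi phiq Uw.
have hS w (Uw' : Uad Omega ul uu w) : higher_integrable Omega s (S w).
  exact: (state_higher_integrable Hs2 Hstate Hs Hf HfD Uw').
have l12 : 1 <= 2 :> R by rewrite ler1n.
(* An arbitrary derivative is compared with the one constructed from the linearized equation. *)
have TS' : W1_norm Omega 2 (T phi - S' phi) = 0%E.
  by apply: (feasible_derivative_unique mO fO Hs2 Hq derT derS') => // w /hS[].
have [ul0 uluu] : 0 <= ul /\ ul <= uu by case/andP: Hbounds => /ltW.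
have uM := Uad_ae_bounded ul0 uluu Hu.
have uu0 : 0 <= uu by exact: le_trans uluu.
have Tsol := solves_linearized_state mO fO Hs2 Hq Hstate Hu phiq (hS _ Hu).
have S'2 : W1 Omega 2 (S' phi) by have [[W _ _] _] := derS'; exact: W.
have [TW Tlin] := Tsol; have [T2 _] := TW.
split.
  (* The vanishing trace and the weak equation are properties of the class, so they pass from T phi
     to S' phi. *)
  have S'T := W1_norm_sub0_sym mO fO l12 T2 S'2 TS'.
  apply/solves_linearizedP; split; first exact: W10_of_norm_sub0 TW S'2 S'T.
  move=> v vW; have [v2 _] := vW.
  by rewrite -(energy_norm_sub0 mO fO uu0 uM T2 S'2 v2 TS') Tlin.
move=> z /solves_linearizedP zsol; have [[z2 _] _] := zsol.
apply: (W1_norm_sub0_trans mO fO l12 z2 T2 S'2) => //.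
exact: (solves_linearized_unique mO fO Hs2 Hq Hstate Hu phiq (hS _ Hu) zsol Tsol).
Qed.
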